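(* Let $\mathcal{H}$ be a complex Hilbert space and let $Q\subset\mathbb{C}^n$ be a complete circular domain centered at $0\in Q$. Let $f:Q\to\mathcal{B}(\mathcal{H})$ be given by a series of homogeneous polynomials $f(z)=\sum_{k=0}^{\infty}P_k(z)$ converging in $Q$, such that $\|f(z)\|<1$ for all $z\in Q$ and $f(0)=a_0I$ with $a_0\in\mathbb{C}$, $|a_0|<1$. Then for every $p\in(0,1]$ and every integer $N\ge 1$, $$\|f(z)\|^p+\sum_{k=N}^{\infty}\|P_k(z)\|\le 1$$ for all $z$ in the homothetic domain $(R_{N,p})Q$, where $R_{N,p}$ is the positive root in $(0,1)$ of the equation $$2(1+r)r^N-p(1-r)^2=0.$$ Moreover, if $Q$ is convex, then the constant $R_{N,p}$ is the best possible, i.e. for every $\rho\in(R_{N,p},1)$ there is a function $f:Q\to\mathcal{B}(\mathcal{H})$, given by a series of homogeneous polynomials $f(z)=\sum_{k=0}^{\infty}P_k(z)$ converging in $Q$, with $\|f(z)\|<1$ for all $z\in Q$ and $f(0)=a_0I$ for some $a_0\in\mathbb{C}$, $|a_0|<1$, for which the inequality fails at some point of $\rho Q$.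
   Context: $\mathcal{B}(\mathcal{H})$ is the algebra of all bounded linear operators on $\mathcal{H}$ with the operator norm $\|\cdot\|$, and $I$ is the identity operator. A domain $Q\subset\mathbb{C}^n$ is a complete circular domain centered at $0\in Q$ if for each $z=(z_1,\dots,z_n)\in Q$ and each $\xi\in\mathbb{C}$ with $|\xi|\le 1$ one has $(\xi z_1,\dots,\xi z_n)\in Q$. Every analytic function $f:Q\to\mathcal{B}(\mathcal{H})$ has an expansion $f(z)=\sum_{k=0}^\infty P_k(z)$, where $P_k(z)=\sum_{|\alpha|=k}A_\alpha z^\alpha$, $A_\alpha\in\mathcal{B}(\mathcal{H})$ (standard multi-index notation), is a homogeneous polynomial of degree $k$ and $P_0(z)=f(0)$. For $\rho>0$, $\rho Q=\{\rho z: z\in Q\}$.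
   Formalization: In the sharpness part, Q is additionally assumed different from C^n and H different from {0}; in these cases (by Liouville's theorem, resp. because all norms vanish) the inequality always holds, so the claim is false as written. *)

(* Defs.v *)
From HB Require Import structures.
From mathcomp Require Import all_boot all_order all_algebra sesquilinear.
From mathcomp Require Import complex.
From mathcomp Require Import all_classical all_reals all_analysis.

Set Implicit Arguments.
Unset Strict Implicit.
Unset Printing Implicit Defensive.

Import Order.TTheory GRing.Theory Num.Theory.
Import numFieldNormedType.Exports.

Local Open Scope classical_set_scope.
Local Open Scope ring_scope.
Local Open Scope complex_scope.

(* MathComp-Analysis puts these structures on [K : numFieldType] only through
   the coercion to the carrier, so unification does not find them on the
   concrete carrier [R[i]]; they are the same structures, copied. *)
HB.instance Definition _ (R : realType) := GRing.ComAlgebra.copy R[i] R[i]^o.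
HB.instance Definition _ (R : realType) := Vector.copy R[i] R[i]^o.
HB.instance Definition _ (R : realType) := NormedModule.copy R[i] R[i]^o.

Section BoundedOperators.
Context {R : realType} (H : normedModType R[i]).

Definition bounded_linear : {pred H -> H} :=
  [pred T : H -> H |
    `[< linear T /\ exists M : R, forall x, `|T x| <= M%:C * `|x| >]].

Record bounded_op : Type := BoundedOp {
  bounded_op_fun :> H -> H;
  bounded_op_mem : bounded_op_fun \in bounded_linear }.

HB.instance Definition _ := [isSub for bounded_op_fun].
HB.instance Definition _ := [Choice of bounded_op by <:].

Lemma bounded_linearP (T : H -> H) :
  reflect (linear T /\ exists M : R, forall x, `|T x| <= M%:C * `|x|)
          (T \in bounded_linear).
Proof. exact: asboolP. Qed.

Lemma bounded_linear_submod_closed : submod_closed bounded_linear.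
Proof.
split.
  apply/bounded_linearP; split; last by exists 0 => x; rewrite normr0 mul0r.
  by move=> a u v; rewrite -[LHS]/0 -[RHS]/(a *: 0 + 0) scaler0 addr0.
move=> a S T /bounded_linearP[linS [M SM]] /bounded_linearP[linT [L TL]].
apply/bounded_linearP; split=> [b u v|].
  rewrite -[LHS]/(a *: S _ + T _) -[RHS]/(b *: (a *: S u + T u) + (a *: S v + T v)).
  rewrite linS linT !scalerDr !scalerA [b * a]mulrC -!addrA.
  by congr (_ + _); rewrite addrCA.
exists (Normc.normc a * M + L) => x; rewrite -[(_ + _) x]/(a *: S x + T x).
rewrite (le_trans (ler_normD _ _))// normrZ rmorphD rmorphM/= mulrDl lerD//.
by rewrite -[(Normc.normc a)%:C]/`|a| -mulrA ler_wpM2l.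
Qed.

HB.instance Definition _ :=
  GRing.isSubmodClosed.Build _ _ bounded_linear bounded_linear_submod_closed.
HB.instance Definition _ := [SubChoice_isSubLmodule of bounded_op by <:].

Lemma bounded_opDE (S T : bounded_op) x : (S + T) x = S x + T x.
Proof. by []. Qed.

Lemma bounded_opZE a (T : bounded_op) x : (a *: T) x = a *: T x.
Proof. by []. Qed.

Fact id_bounded_linear : (idfun : H -> H) \in bounded_linear.
Proof.
by apply/bounded_linearP; split=> [a u v //|]; exists 1 => x; rewrite mul1r.
Qed.

Definition id_op : bounded_op := BoundedOp id_bounded_linear.

(* Norms valued in [R[i]] are real; [complex.Re] reads them in [R]. *)
Definition opnorm (T : bounded_op) : R :=
  sup [set complex.Re `|T x| | x in [set x : H | `|x| <= 1]].

Lemma opnorm_le (T : bounded_op) (M : R) :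
  (forall x, `|x| <= 1 -> `|T x| <= M%:C) -> opnorm T <= M.
Proof.
move=> TM; apply: ge_sup.
  by exists (complex.Re `|T 0|), 0 => //=; rewrite normr0.
move=> _ [x /= x1 <-].
by rewrite -lecR RRe_real ?normr_real// TM.
Qed.

Lemma le_opnorm1 (T : bounded_op) x : `|x| <= 1 -> `|T x| <= (opnorm T)%:C.
Proof.
move=> x1; rewrite -[leLHS]RRe_real ?normr_real// lecR.
apply: ub_le_sup; last by exists x.
have /bounded_linearP[_ [M TM]] := bounded_op_mem T.
exists `|M| => _ [y /= y1 <-].
rewrite -lecR RRe_real ?normr_real// (le_trans (TM y))//.
rewrite (@le_trans _ _ (`|M|%:C * `|y|))//; first by rewrite ler_wpM2r ?lecR ?ler_norm.
by rewrite ler_piMr// ler0c.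
Qed.

Lemma opnorm_ge0 (T : bounded_op) : 0 <= opnorm T.
Proof.
by rewrite -ler0c (le_trans _ (@le_opnorm1 T 0 _))// normr0.
Qed.

Lemma le_opnorm (T : bounded_op) x : `|T x| <= (opnorm T)%:C * `|x|.
Proof.
have /bounded_linearP[linT _] := bounded_op_mem T.
pose L : {linear H -> H} :=
  HB.pack (T : H -> H) (GRing.isLinear.Build _ _ _ _ (T : H -> H) linT).
have [->|x0] := eqVneq x 0; first by rewrite -[T 0]/(L 0) linear0 !normr0 mulr0.
rewrite -ler_pdivrMr ?normr_gt0// mulrC.
rewrite -[_^-1]ger0_norm ?invr_ge0// -normrZ -[T x]/(L x) -linearZ.
by apply: le_opnorm1; rewrite normrZ normfV normr_id mulVf ?normr_eq0.
Qed.

Lemma opnormD (S T : bounded_op) :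
  (opnorm (S + T))%:C <= (opnorm S)%:C + (opnorm T)%:C.
Proof.
rewrite -rmorphD lecR; apply: opnorm_le => x x1.
by rewrite bounded_opDE rmorphD/= (le_trans (ler_normD _ _))// lerD ?le_opnorm1.
Qed.

Lemma opnormZ a (T : bounded_op) :
  (opnorm (a *: T))%:C = `|a| * (opnorm T)%:C.
Proof.
have le_opnormZ (b : R[i]) (S : bounded_op) :
    (opnorm (b *: S))%:C <= `|b| * (opnorm S)%:C.
  rewrite -[`|b|]/(Normc.normc b)%:C -rmorphM lecR.
  apply: opnorm_le => x x1; rewrite bounded_opZE normrZ rmorphM/=.
  by rewrite -[(Normc.normc b)%:C]/`|b| ler_wpM2l ?le_opnorm1.
apply/eqP; rewrite eq_le le_opnormZ/=.
have [->|a0] := eqVneq a 0; first by rewrite normr0 mul0r ler0c opnorm_ge0.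
rewrite mulrC -ler_pdivlMr ?normr_gt0// mulrC -normfV.
by rewrite (le_trans _ (le_opnormZ _ _))// scalerA mulVf// scale1r.
Qed.

Lemma opnorm_eq0 (T : bounded_op) : (opnorm T)%:C = 0 -> T = 0.
Proof.
move=> T0; apply/val_inj/funext => x; apply/eqP.
by rewrite -[_ == _]normr_le0 (le_trans (le_opnorm T x))// T0 mul0r.
Qed.

HB.instance Definition _ :=
  Lmodule_isNormed.Build R[i] bounded_op opnormD opnormZ opnorm_eq0.

Lemma bounded_op_normE (T : bounded_op) : `|T| = (opnorm T)%:C.
Proof. by []. Qed.

End BoundedOperators.

Section HomogeneousSeries.
Context {R : realType} {n : nat}.

Definition complete_circular_domain (Q : set 'rV[R[i]]_n) : Prop :=
  [/\ open Q, connected Q, Q 0 &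
      forall (xi : R[i]) z, Q z -> `|xi| <= 1 -> Q (xi *: z)].

Definition dilation (rho : R) (Q : set 'rV[R[i]]_n) : set 'rV[R[i]]_n :=
  [set rho%:C *: z | z in Q].

(* Every entry of a multi-index of weight [k] is at most [k], so the sum over
   all of them is a sum over the finite type ['I_k.+1 ^ n]. *)
Definition homogeneous_poly (V : lmodType R[i]) (k : nat)
    (P : 'rV[R[i]]_n -> V) : Prop :=
  exists A : {ffun 'I_n -> nat} -> V, forall z,
    P z = \sum_(alpha : {ffun 'I_n -> 'I_k.+1} | (\sum_j alpha j == k)%N)
            (\prod_j z 0 j ^+ alpha j) *: A [ffun j => alpha j : nat].

Definition homogeneous_expansion (V : normedModType R[i])
    (Q : set 'rV[R[i]]_n) (f : 'rV[R[i]]_n -> V)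
    (P : nat -> 'rV[R[i]]_n -> V) : Prop :=
  (forall k, homogeneous_poly k (P k)) /\
  (forall z, Q z -> series (P ^~ z) @ \oo --> f z).

End HomogeneousSeries.

Section BohrInequality.
Context {R : realType} {H : normedModType R[i]} {n : nat}.

Definition bohr_admissible (Q : set 'rV[R[i]]_n)
    (f : 'rV[R[i]]_n -> bounded_op H)
    (P : nat -> 'rV[R[i]]_n -> bounded_op H) : Prop :=
  [/\ homogeneous_expansion Q f P,
      forall z, Q z -> opnorm (f z) < 1 &
      exists2 a0 : R[i], `|a0| < 1 & f 0 = a0 *: id_op H].

(* The series of norms is summed in [\bar R]: divergence to [+oo] counts as a
   failure of the inequality. *)
Definition bohr_inequality (p : R) (N : nat) (f : 'rV[R[i]]_n -> bounded_op H)
    (P : nat -> 'rV[R[i]]_n -> bounded_op H) (z : 'rV[R[i]]_n) : Prop :=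
  ((opnorm (f z) `^ p)%:E + \sum_(N <= k <oo) (opnorm (P k z))%:E <= 1)%E.

End BohrInequality.

Definition bohr_radius_eq {R : realType} (p : R) (N : nat) (r : R) : Prop :=
  0 < r < 1 /\ 2 * (1 + r) * r ^+ N - p * (1 - r) ^+ 2 = 0.

(* Main.v *)
(* Fix z0 in Q, put A_k = P_k(z0) and a = a_0, and consider the disc slice
   g(l) = f(l z0) = sum_k l^k A_k, which is bounded by 1 on the closed unit disc.
   Averaging over roots of unity shows that the lower triangular Toeplitz
   operator with symbol g contracts l^2(H).  Testing it on x + c A_k x l^k gives
   |A_k| <= 1 - |a|^2; testing it on the Taylor coefficients of
   x (1 + l) / (1 - r l) gives the operator form of Harnack's inequality,
   |g(r)| <= 1 - (1 - |a|) (1 - r) / (1 + r).  As t^p <= 1 - p (1 - t), the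
   left-hand side of the Bohr inequality at r z0 is at most
   1 - (1 - |a|) (p (1 - r) / (1 + r) - 2 r^N / (1 - r)), and the last factor
   vanishes at the Bohr radius.

   For sharpness, the Hahn-Banach theorem gives a linear form L with sup |L| = 1
   on the convex set Q; the extremal functions are (a + L) / (1 + a L) times the
   identity, with a close to 1. *)

Require Import Defs.
From HB Require Import structures.
From mathcomp Require Import all_boot all_order all_algebra sesquilinear.
From mathcomp Require Import complex.
From mathcomp Require Import all_classical all_reals all_analysis.
From mathcomp Require Import cyclic separable cyclotomic.
From mathcomp Require polyrcf.
From mathcomp Require Import ring lra.

Set Implicit Arguments.
Unset Strict Implicit.
Unset Printing Implicit Defensive.

Import Order.TTheory GRing.Theory Num.Theory.
Import numFieldNormedType.Exports.

Local Open Scope classical_set_scope.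
Local Open Scope ring_scope.

(** * Toeplitz contractions *)

(** In characteristic 0 the polynomial ['X^M - 1] is separable, so its [M] roots are distinct, and
    [M] distinct roots of unity of order dividing [M] include a primitive one. *)
Lemma ex_prim_root (C : numClosedFieldType) (M : nat) :
  (0 < M)%N -> {w : C | M.-primitive_root w}.
Proof.
move=> M0; pose p : {poly C} := 'X^M - 1.
have [r Dp] := closed_field_poly_normal p.
apply/sigW.
rewrite (monicP _) ?monicXnsubC // scale1r in Dp.
have rn : all M.-unity_root r by apply/allP=> z; rewrite -root_prod_XsubC -Dp.
have sr : (M < (size r).+1)%N.
  by rewrite -(size_prod_XsubC r id) -Dp size_XnsubC.
have [|z] := hasP (has_prim_root M0 rn _ sr); last by exists z.
rewrite -separable_prod_XsubC -Dp separable_Xn_sub_1 //.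
by rewrite pnatr_eq0 -lt0n.
Qed.

(** * Discrete Parseval identity over roots of unity *)

Section Parseval.
Context {C : numClosedFieldType} {H : lmodType C} (dot : {dot H for Num.conj}).
Implicit Types (w : C).

Lemma sum_prim_root w M d : M.-primitive_root w -> (0 < d < M)%N ->
  \sum_(j < M) w ^+ (d * j) = 0.
Proof.
move=> wM /andP[d0 dM].
have wd : w ^+ d != 1.
  by rewrite -(expr0 w) (eq_prim_root_expr wM) mod0n modn_small// -lt0n.
apply/eqP; have := subrX1 (w ^+ d) M.
rewrite -exprM mulnC exprM (prim_expr_order wM) expr1n subrr => /esym/eqP.
rewrite mulf_eq0 subr_eq0 (negbTE wd)/= => /eqP s0.
by rewrite -[X in _ == X]s0; apply/eqP/eq_bigr => j _; rewrite exprM.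
Qed.

Lemma norm_prim_root w M : M.-primitive_root w -> `|w| = 1.
Proof.
move=> wM; apply/eqP; rewrite -(@pexpr_eq1 _ _ M) ?(prim_order_gt0 wM)//.
by rewrite -normrX (prim_expr_order wM) normr1.
Qed.

(** Orthogonality of characters: off the diagonal this is a full geometric sum with ratio a power of
    [w] different from 1, up to a conjugation when [k < l]. *)
Lemma sum_prim_root_conj w M (k l : 'I_M) : M.-primitive_root w ->
  \sum_(j < M) w ^+ (k * j) * (w ^+ (l * j))^* = M%:R *+ (k == l).
Proof.
move=> wM; have w1 := norm_prim_root wM.
have ww n : w ^+ n * (w ^+ n)^* = 1 by rewrite -normCK normrX w1 !expr1n.
have [->|kl] := eqVneq k l.
  under eq_bigr do rewrite ww.
  by rewrite sumr_const card_ord.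
rewrite mulr0n; have [lk|lk] := ltnP l k.
  under eq_bigr => j _.
    rewrite (_ : _ * _ = w ^+ ((k - l) * j)); first over.
    by rewrite -{1}(subnK (ltnW lk)) mulnDl exprD -mulrA ww mulr1.
  by apply: sum_prim_root => //; rewrite subn_gt0 lk (leq_ltn_trans (leq_subr _ _)).
have kll : \sum_(j < M) w ^+ ((l - k) * j) = 0.
  apply: sum_prim_root => //; rewrite subn_gt0 ltn_neqAle kl lk/=.
  exact: leq_ltn_trans (leq_subr _ _) _.
apply: (can_inj (@conjCK C)); rewrite conjC0 -[RHS]kll rmorph_sum.
apply: eq_bigr => j _; rewrite rmorphM/= conjCK -{1}(subnK lk) mulnDl exprD.
by rewrite mulrC -mulrA ww mulr1.
Qed.

(** After both arguments are expanded, orthogonality of the characters leaves only the diagonal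
    terms. *)
Lemma parseval_prim_root w M (y : 'I_M -> H) : M.-primitive_root w ->
  \sum_(j < M) dot (\sum_(k < M) w ^+ (k * j) *: y k)
                   (\sum_(k < M) w ^+ (k * j) *: y k)
  = M%:R * \sum_(k < M) dot (y k) (y k).
Proof.
move=> wM.
transitivity (\sum_(k < M) \sum_(l < M)
   (\sum_(j < M) w ^+ (k * j) * (w ^+ (l * j))^*) * dot (y k) (y l)).
  under eq_bigr => j _.
    rewrite linear_sumlz/=.
    under eq_bigr => k _.
      rewrite linearZl_LR linear_sumr/= mulr_sumr.
      under eq_bigr => l _ do rewrite linearZr_LR/= mulrA.
      over.
    over.
  rewrite exchange_big; apply: eq_bigr => k _.
  rewrite exchange_big; apply: eq_bigr => l _.
  by rewrite mulr_suml.
rewrite mulr_sumr; apply: eq_bigr => k _.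
rewrite (bigD1 k)//= sum_prim_root_conj// eqxx big1 ?addr0// => l lk.
by rewrite sum_prim_root_conj// eq_sym (negbTE lk) mulr0n mul0r.
Qed.

End Parseval.

Section BoundedOpLinear.
Context {R : realType} {H : normedModType R[i]}.

Lemma bounded_op_linear (T : bounded_op H) : linear T.
Proof. by have /bounded_linearP[] := bounded_op_mem T. Qed.

HB.instance Definition _ (T : bounded_op H) :=
  GRing.isLinear.Build _ _ _ _ (bounded_op_fun T) (bounded_op_linear T).

Lemma bounded_op_sumE I (r : seq I) (P : pred I) (F : I -> bounded_op H) x :
  (\sum_(i <- r | P i) F i) x = \sum_(i <- r | P i) F i x.
Proof. by elim/big_rec2: _ => // i y T _ <-; rewrite bounded_opDE. Qed.

End BoundedOpLinear.

(** * Toeplitz operators with polynomial symbol *)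

Section Toeplitz.
Context {R : realType} {H : normedModType R[i]}.
Variables (dot : {dot H for Num.conj}) (dotE : forall u : H, dot u u = `|u| ^+ 2).
Implicit Types (A : nat -> bounded_op H) (x : nat -> H).

Let parseval w M (y : 'I_M -> H) : M.-primitive_root w ->
  \sum_(j < M) `|\sum_(k < M) w ^+ (k * j) *: y k| ^+ 2
  = M%:R * \sum_(k < M) `|y k| ^+ 2.
Proof.
move=> wM; under eq_bigr do rewrite -dotE.
by rewrite (parseval_prim_root dot y wM); under eq_bigr do rewrite dotE.
Qed.

(** The Toeplitz outputs are the low coefficients of the product of the polynomials with
    coefficients [A a] and [x i]. Parseval turns the pointwise bound at roots of unity into a bound
    on the squared coefficients, and the high coefficients are dropped. *)
Lemma toeplitz_poly_contraction A x (B : R[i]) (K m : nat) : (m <= K)%N ->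
  0 <= B ->
  (forall w v, `|w| = 1 -> `|\sum_(a < K) w ^+ a *: A a v| <= B * `|v|) ->
  \sum_(k < m) `|\sum_(i < k.+1) A (k - i)%N (x i)| ^+ 2
    <= B ^+ 2 * \sum_(i < m) `|x i| ^+ 2.
Proof.
move=> mK B0 AB; case: m => [|m] in mK *; first by rewrite !big_ord0 mulr0.
(* The product, whose coefficients are [y] below, has degree less than [M], so nothing wraps around
   at the [M]-th roots of unity. *)
pose M := (K + m.+1)%N.
have M0 : (0 < M)%N by rewrite /M addnS.
have [w wM] := ex_prim_root (R[i] : numClosedFieldType) M0.
pose y (k : 'I_M) : H :=
  \sum_(i < m.+1) \sum_(a < K | (a + i == k)%N) A a (x i).
pose x' (k : 'I_M) : H := if (k < m.+1)%N then x k else 0.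
have mM : (m.+1 <= M)%N by rewrite leq_addl.
have x'E (F : nat -> H -> R[i]) : (forall k, F k 0 = 0) ->
    \sum_(k < M) F k (x' k) = \sum_(k < m.+1) F k (x k).
  move=> F0; rewrite (big_ord_widen _ (fun k => F k (x k)) mM) [RHS]big_mkcond/=.
  by apply: eq_bigr => k _; rewrite /x'; case: ifP.
have x'V (F : nat -> R[i]) :
    \sum_(k < M) F k *: x' k = \sum_(k < m.+1) F k *: x k.
  rewrite (big_ord_widen _ (fun k => F k *: x k) mM) [RHS]big_mkcond/=.
  by apply: eq_bigr => k _; rewrite /x'; case: ifP; rewrite ?scaler0.
have yE (j : 'I_M) : \sum_(k < M) w ^+ (k * j) *: y k =
    \sum_(a < K) (w ^+ j) ^+ a *: A a (\sum_(k < M) w ^+ (k * j) *: x' k).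
  rewrite (x'V (fun k => w ^+ (k * j))).
  under eq_bigr do rewrite scaler_sumr.
  rewrite exchange_big/=.
  under [RHS]eq_bigr do rewrite linear_sum scaler_sumr.
  rewrite [RHS]exchange_big/=; apply: eq_bigr => i _.
  under eq_bigr do rewrite scaler_sumr big_mkcond/=.
  rewrite exchange_big/=; apply: eq_bigr => a _.
  have aiM : (a + i < M)%N by rewrite /M -addnS leq_add// ltnW.
  rewrite (bigD1 (Ordinal aiM))//= eqxx big1 ?addr0 => [|k]; last first.
    by rewrite -(inj_eq val_inj)/= eq_sym => /negbTE ->.
  by rewrite linearZ scalerA/= -exprM -exprD mulnDl [(j * a)%N]mulnC.
have yxM : \sum_(k < M) `|y k| ^+ 2 <= B ^+ 2 * \sum_(k < M) `|x' k| ^+ 2.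
  have M0' : 0 < M%:R :> R[i] by rewrite ltr0n.
  rewrite -(ler_pM2l M0') mulrCA -!(parseval _ wM) mulr_sumr.
  apply: ler_sum => j _; rewrite yE -exprMn ler_pXn2r ?nnegrE ?mulr_ge0//.
  by apply: AB; rewrite normrX (norm_prim_root wM) expr1n.
rewrite (x'E (fun k v => `|v| ^+ 2)) in yxM; last by move=> _; rewrite normr0 expr0n.
apply: le_trans yxM.
rewrite (big_ord_widen _ (fun k => `|\sum_(i < k.+1) A (k - i)%N (x i)| ^+ 2) mM).
rewrite big_mkcond/=; apply: ler_sum => k _; case: ifPn => km; last by rewrite exprn_ge0.
(* Truncating the symbol at [K] loses nothing here, since [k - i < K]; for [i > k] the inner sum is
   empty. *)
suff -> : y k = \sum_(i < k.+1) A (k - i)%N (x i) by [].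
rewrite (big_ord_widen _ (fun i => A (k - i)%N (x i)) km) big_mkcond/=.
apply: eq_bigr => i _; rewrite ltnS; case: ifPn => ik.
  have kiK : (k - i < K)%N by rewrite (leq_trans _ mK)// (leq_ltn_trans (leq_subr _ _)).
  rewrite (big_pred1 (Ordinal kiK))// => a/=.
  by rewrite -(inj_eq val_inj) -[RHS](eqn_add2r i) subnK.
rewrite big1// => a /eqP aik; move: ik; rewrite -aik leq_addl//.
Qed.

End Toeplitz.

(** * Real-valued norms and limits *)

Section RealNorm.
Context {R : realType}.

(** Norms take values in [R[i]], whose order is only partial; [rnorm] moves the estimates to [R]. *)
Definition rnorm (V : normedModType R[i]) (x : V) : R := complex.Re `|x|.

Lemma rnormE (V : normedModType R[i]) (x : V) : `|x| = (rnorm x)%:C%C.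
Proof. by rewrite /rnorm RRe_real ?normr_real. Qed.

Lemma rnorm_le (V : normedModType R[i]) (x : V) (b : R) :
  (rnorm x <= b) = (`|x| <= b%:C%C).
Proof. by rewrite rnormE lecR. Qed.

Lemma rnorm_ge0 (V : normedModType R[i]) (x : V) : 0 <= rnorm x.
Proof. by rewrite -ler0c -rnormE. Qed.

Lemma rnormD (V : normedModType R[i]) (x y : V) : rnorm (x + y) <= rnorm x + rnorm y.
Proof. by rewrite rnorm_le rmorphD/= -!rnormE ler_normD. Qed.

Lemma rnormN (V : normedModType R[i]) (x : V) : rnorm (- x) = rnorm x.
Proof. by rewrite /rnorm normrN. Qed.

Lemma rnormB (V : normedModType R[i]) (x y : V) : rnorm (x - y) = rnorm (y - x).
Proof. by rewrite -rnormN opprB. Qed.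

Lemma rnorm0 (V : normedModType R[i]) : rnorm (0 : V) = 0.
Proof. by rewrite /rnorm normr0. Qed.

Lemma rnorm_sum (V : normedModType R[i]) I (r : seq I) (P : pred I) (F : I -> V) :
  rnorm (\sum_(i <- r | P i) F i) <= \sum_(i <- r | P i) rnorm (F i).
Proof.
elim/big_rec2: _ => [|i a b _ ab]; first by rewrite rnorm0.
by rewrite (le_trans (rnormD _ _))// lerD2l.
Qed.

Lemma rnormZ (V : normedModType R[i]) (a : R[i]) (x : V) :
  rnorm (a *: x) = rnorm (a : R[i]) * rnorm x.
Proof. by apply: (@complexI R); rewrite rmorphM/= -!rnormE normrZ. Qed.

Lemma rnorm_eq0 (V : normedModType R[i]) (x : V) : (rnorm x == 0) = (x == 0).
Proof. by rewrite -(inj_eq (@complexI R)) -rnormE normr_eq0. Qed.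

Lemma rnormCR (b : R) : rnorm (b%:C%C : R[i]) = `|b|.
Proof.
by rewrite /rnorm normc_def/= expr0n addr0 sqrtr_sqr.
Qed.

Lemma cvg_rnormP (V : normedModType R[i]) (u : nat -> V) (l : V) :
  u @ \oo --> l <-> (fun n => rnorm (u n - l)) @ \oo --> (0 : R).
Proof.
split=> ul.
  apply/cvgrPdist_lt => e e0.
  have e0C : 0 < (e%:C)%C :> R[i] by rewrite ltcR.
  move/cvgrPdist_lt/(_ _ e0C): ul; apply: filterS => n.
  by rewrite rnormE ltcR sub0r normrN ger0_norm ?rnorm_ge0// rnormB.
apply/cvgrPdist_lt => e e0.
(* A positive element of [R[i]] is real. *)
have eE : e = ((complex.Re e)%:C)%C by rewrite RRe_real// ger0_real// ltW.
have e0R : 0 < complex.Re e by rewrite -ltcR -eE.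
move/cvgrPdist_lt/(_ _ e0R): ul; apply: filterS => n.
by rewrite sub0r normrN ger0_norm ?rnorm_ge0// rnormB eE rnormE ltcR.
Qed.

Lemma rnorm_cvg_le (V : normedModType R[i]) (u : nat -> V) (l : V) (b : R) :
  u @ \oo --> l -> (\forall n \near \oo, rnorm (u n) <= b) -> rnorm l <= b.
Proof.
move=> /cvg_rnormP ul ub; apply/ler_addgt0Pr => e e0.
have [N _ /(_ N (leqnn N))[]] : \forall n \near \oo,
    rnorm (u n) <= b /\ `|0 - rnorm (u n - l)| < e.
  by near=> n; split; near: n => //; move/cvgrPdist_lt: ul; apply.
move=> uNb; rewrite sub0r normrN ger0_norm ?rnorm_ge0// => uNe.
rewrite -(subrK (u N) l) addrC (le_trans (rnormD _ _))// lerD//.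
by rewrite rnormB ltW.
Unshelve. all: by end_near. Qed.

Lemma cvg_rnorm_squeeze (V : normedModType R[i]) (u : nat -> V) (l : V) (e : nat -> R) :
  (forall n, rnorm (u n - l) <= e n) -> e @ \oo --> (0 : R) -> u @ \oo --> l.
Proof.
move=> ue e0; apply/cvg_rnormP; apply: (squeeze_cvgr _ _ e0); last exact: cvg_cst.
by near=> n; rewrite rnorm_ge0 ue.
Unshelve. all: by end_near. Qed.

Lemma sum_geometric_le (q : R) (k m : nat) : 0 <= q < 1 ->
  \sum_(k <= i < m) q ^+ i <= q ^+ k / (1 - q).
Proof.
move=> /andP[q0 q1]; rewrite ler_pdivlMr ?subr_gt0//.
have [mk|/ltnW km] := leqP m k; first by rewrite big_geq// mul0r exprn_ge0.
rewrite mulr_suml.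
under eq_bigr do rewrite mulrBr mulr1 -exprSr -opprB.
by rewrite sumrN telescope_sumr// opprB gerBl exprn_ge0.
Qed.

End RealNorm.

(** * Toeplitz contractions from power series bounded by 1 on the closed disc *)

Section SchurClass.
Context {R : realType} {H : normedModType R[i]}.
Variables (dot : {dot H for Num.conj}) (dotE : forall u : H, dot u u = `|u| ^+ 2).

Lemma rnorm_bounded_op (T : bounded_op H) : rnorm T = opnorm T.
Proof. by []. Qed.

Lemma rnorm_opnorm (T : bounded_op H) x : rnorm (T x) <= opnorm T * rnorm x.
Proof. by rewrite rnorm_le rmorphM/= -rnormE le_opnorm. Qed.

Lemma opnorm_rnorm_le (T : bounded_op H) (b : R) : 0 <= b ->
  (forall x, rnorm (T x) <= b * rnorm x) -> opnorm T <= b.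
Proof.
move=> b0 Tb; apply: opnorm_le => x; rewrite rnormE lecR => x1.
by rewrite -rnorm_le (le_trans (Tb x))// ler_piMr.
Qed.

Variables (A : nat -> bounded_op H) (g : R[i] -> bounded_op H) (c q : R).
Hypotheses (q01 : 0 <= q < 1) (Aq : forall k, opnorm (A k) <= c * q ^+ k).
Hypothesis gE : forall w : R[i], rnorm w <= 1 ->
  series (fun k => w ^+ k *: A k) @ \oo --> g w.
Hypothesis g1 : forall w : R[i], rnorm w <= 1 -> opnorm (g w) <= 1.

Let c0 : 0 <= c.
Proof. by rewrite (le_trans (opnorm_ge0 (A 0)))// (le_trans (Aq 0))// mulr1. Qed.

(** The full sum [g w] contributes 1; the tail beyond [K] is dominated by a geometric series. *)
Lemma opnorm_partial_sum_le (w : R[i]) K : rnorm w <= 1 ->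
  opnorm (\sum_(a < K) w ^+ a *: A a) <= 1 + c * q ^+ K / (1 - q).
Proof.
move=> w1; rewrite -rnorm_bounded_op.
have G_cvg : (fun n => \sum_(a < K) w ^+ a *: A a - series (fun k => w ^+ k *: A k) n)
    @ \oo --> \sum_(a < K) w ^+ a *: A a - g w.
  by apply: cvgB; [exact: cvg_cst|exact: gE].
rewrite -(subrK (g w) (\sum_(a < K) _)) addrC (le_trans (rnormD _ _))// lerD ?g1//.
apply: (rnorm_cvg_le G_cvg); near=> n; rewrite rnormB /series/=.
rewrite -(big_mkord predT (fun a => w ^+ a *: A a)) (@big_cat_nat _ _ _ K)//=; last first.
  by near: n; exact: nbhs_infty_ge.
rewrite addrAC subrr add0r (le_trans (rnorm_sum _ _ _))// -mulrA.
apply: le_trans (ler_wpM2l c0 (sum_geometric_le K n q01)).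
rewrite mulr_sumr; apply: ler_sum => a _; rewrite rnormZ (le_trans _ (Aq a))//.
rewrite ler_piMl ?opnorm_ge0//.
rewrite -lecR -rnormE normrX exprn_ile1 ?normr_ge0//.
by rewrite rnormE -[1]/(1%:C)%C lecR.
Unshelve. all: by end_near. Qed.

(** For [K >= m] the left side sees only coefficients kept by the truncation at [K]. The polynomial
    case applies with bound [B K], which tends to 1 as [K] grows. *)
Lemma toeplitz_contraction (x : nat -> H) m :
  \sum_(k < m) rnorm (\sum_(i < k.+1) A (k - i)%N (x i)) ^+ 2
    <= \sum_(i < m) rnorm (x i) ^+ 2.
Proof.
set S := (X in X <= _); set X := (X in _ <= X).
pose B K := 1 + c * q ^+ K / (1 - q).
have B0 K : 0 <= B K.
  rewrite addr_ge0// divr_ge0 ?mulr_ge0 ?exprn_ge0//; first by case/andP: q01.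
  by rewrite subr_ge0; case/andP: q01 => _ /ltW.
have SX K : (m <= K)%N -> S <= B K ^+ 2 * X.
  move=> mK; rewrite -lecR rmorphM rmorphXn !rmorph_sum/=.
  under eq_bigr do rewrite rmorphXn/= -rnormE.
  under [in leRHS]eq_bigr do rewrite rmorphXn/= -rnormE.
  apply: (toeplitz_poly_contraction dotE x mK); first by rewrite ler0c.
  move=> w v w1; rewrite [`|v|]rnormE -rmorphM -rnorm_le.
  have -> : \sum_(a < K) w ^+ a *: A a v = (\sum_(a < K) w ^+ a *: A a) v.
    by rewrite bounded_op_sumE; apply: eq_bigr.
  rewrite (le_trans (rnorm_opnorm _ _))// ler_wpM2r ?rnorm_ge0//.
  by apply: opnorm_partial_sum_le; rewrite rnorm_le w1.
have Bcvg : (fun K => B K ^+ 2 * X) @ \oo --> 1 ^+ 2 * X.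
  apply: cvgMl; rewrite (_ : (fun K => B K ^+ 2) = (fun K => B K * B K))//.
  have B1 : B @ \oo --> (1 : R).
    rewrite -[X in _ --> X]addr0; apply: cvgD; first exact: cvg_cst.
    rewrite -(mul0r (1 - q)^-1); apply: cvgMl; rewrite -(mulr0 c); apply: cvgMr.
    by apply: cvg_expr; rewrite ger0_norm; case/andP: q01.
  by rewrite expr2; exact: cvgM.
rewrite -[X]mul1r -(expr1n _ 2); apply: (cvgr_to_ge Bcvg).
by near=> K; apply: SX; near: K; exact: nbhs_infty_ge.
Unshelve. all: by end_near. Qed.

End SchurClass.

(** * Coefficient bound and Harnack inequality *)

Section ToeplitzConsequences.
Context {R : realType} {H : normedModType R[i]}.
Variables (A : nat -> bounded_op H) (a0 : R[i]).
Hypothesis toepA : forall (x : nat -> H) m,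
  \sum_(k < m) rnorm (\sum_(i < k.+1) A (k - i)%N (x i)) ^+ 2
    <= \sum_(i < m) rnorm (x i) ^+ 2.
Hypotheses (A0 : A 0 = a0 *: id_op H) (a01 : rnorm a0 < 1).

Let A0E x : A 0 x = a0 *: x.
Proof. by rewrite A0. Qed.

(** The test sequence has entries [x] at 0 and [b *: A k.+1 x] at [k.+1]. Only the outputs at these
    two indices are used; the others add a nonnegative amount. *)
Lemma toeplitz_coef_le k : opnorm (A k.+1) <= 1 - rnorm a0 ^+ 2.
Proof.
set al := rnorm a0.
have al0 : 0 <= al by exact: rnorm_ge0.
have d0 : 0 < 1 - al ^+ 2 by rewrite subr_gt0 expr_lt1.
apply: opnorm_rnorm_le; first exact: ltW.
move=> x; set s := rnorm _.
(* This [b] minimises |b|^2 - |1 + a0 b|^2. *)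
pose b := (((1 - al ^+ 2)^-1)%:C)%C * a0^*.
pose X i := if i == 0%N then x else if i == k.+1 then b *: A k.+1 x else 0.
have rb : rnorm b = al / (1 - al ^+ 2).
  apply: (@complexI R); rewrite -rnormE /b normrM norm_conjC !rnormE rnormCR.
  by rewrite ger0_norm ?invr_ge0 ?ltW// rmorphM mulrC.
have r1 : rnorm (1 + a0 * b : R[i]) = (1 - al ^+ 2)^-1.
  have -> : 1 + a0 * b = (((1 - al ^+ 2)^-1)%:C)%C.
    rewrite /b mulrCA -normCK rnormE -/al -rmorphXn -rmorphM -(rmorph1 (real_complex R)).
    by rewrite -rmorphD; congr (_%:C)%C; field; rewrite gt_eqF.
  by rewrite rnormCR ger0_norm// invr_ge0 ltW.
have SX : \sum_(i < k.+2) rnorm (X i) ^+ 2 = rnorm x ^+ 2 + rnorm (b *: A k.+1 x) ^+ 2.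
  rewrite big_ord_recl big_ord_recr/= /X /bump/= !add1n eqxx big1 ?add0r// => i _.
  by rewrite add1n eqSS (ltn_eqF (ltn_ord i)) rnorm0 expr0n.
have y0E : \sum_(i < 1) A (0 - i)%N (X i) = a0 *: x.
  by rewrite big_ord_recl big_ord0 addr0 A0E.
have ykE : \sum_(i < k.+2) A (k.+1 - i)%N (X i) = (1 + a0 * b) *: A k.+1 x.
  rewrite big_ord_recl big_ord_recr/= /X /bump/= !add1n eqxx big1 ?add0r => [|i _].
    by rewrite subnn A0E scalerDl scale1r scalerA.
  by rewrite add1n eqSS (ltn_eqF (ltn_ord i)) linear0.
have := toepA X k.+2; rewrite SX big_ord_recl (big_ord_recr k)/= y0E /bump/= add1n ykE.
rewrite (rnormZ a0) (rnormZ b) (rnormZ (1 + a0 * b)) -/al r1 rb -/s.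
set M := \sum_(i < k) _; set y := rnorm x => le.
have M0 : 0 <= M by apply: sumr_ge0 => i _; rewrite exprn_ge0// rnorm_ge0.
have y0 : 0 <= y by exact: rnorm_ge0.
have s0 : 0 <= s by exact: rnorm_ge0.
(* In terms of [t] and [y = rnorm x], contractivity reads [al^2 y^2 + M + t^2 <= y^2 + al^2 t^2],
   hence [t <= y]. *)
set t := (1 - al ^+ 2)^-1 * s in le.
have <- : (1 - al ^+ 2) * t = s by rewrite /t mulrA divff ?mul1r// gt_eqF.
have t0 : 0 <= t by rewrite mulr_ge0// invr_ge0 ltW.
rewrite ler_wpM2l ?(ltW d0)// -(@ler_pXn2r _ 2) ?nnegrE// -(ler_pM2l d0).
move: le; rewrite (_ : al / (1 - al ^+ 2) * s = al * t); last by rewrite /t mulrA.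
by rewrite !exprMn; lra.
Qed.

Variables (r : R) (r01 : 0 < r < 1) (G : bounded_op H).
Hypothesis GE : series (fun k => (r%:C)%C ^+ k *: A k) @ \oo --> G.

Let r0 : 0 < r. Proof. by case/andP: r01. Qed.
Let r1 : r < 1. Proof. by case/andP: r01. Qed.

(* The Poisson kernel minus its minimum (1 - r) / (1 + r) is a multiple of the
   squared modulus of (1 + l) / (1 - r l); [w] lists the coefficients of the
   latter. *)
Let w (k : nat) : R := if k is j.+1 then (1 + r) * r ^+ j else 1.

(** The whole series sums to [1 + (1 + r)^2 / (1 - r^2)], which equals [2 / (1 - r)]. *)
Let w_sum m : \sum_(k < m) w k ^+ 2 <= 2 / (1 - r).
Proof.
have d0 : 0 < 1 - r by rewrite subr_gt0.
case: m => [|m]; first by rewrite big_ord0 divr_ge0// ltW.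
rewrite big_ord_recl/= expr1n.
under eq_bigr do rewrite /= add0n exprMn -exprM mulnC exprM.
rewrite -mulr_sumr -(big_mkord predT (fun i => (r ^+ 2) ^+ i)).
have r21 : 0 <= r ^+ 2 < 1 by rewrite exprn_ge0 ?ltW//= expr_lt1// ltW.
have := sum_geometric_le 0 m r21; rewrite expr0 mul1r => le.
apply: (@le_trans _ _ (1 + (1 + r) ^+ 2 / (1 - r ^+ 2))).
  by rewrite lerD2l ler_wpM2l// exprn_ge0// addr_ge0// ltW.
rewrite le_eqVlt; apply/orP; left; apply/eqP; field.
by rewrite gt_eqF// gt_eqF// subr_gt0 expr_lt1// ltW.
Qed.

Section Vector.
Variable x : H.
(** The Taylor coefficients of Y(l) = (1 + l) / (1 - r l) g(l) x, where g has coefficients [A k];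
    [S m] is a partial sum of (Y(r) - Y(0)) / r. *)
Let y k := \sum_(i < k.+1) A (k - i)%N ((w i)%:C%C *: x).
Let S m := \sum_(k < m) (r%:C)%C ^+ k *: y k.+1.
Let g m := \sum_(k < m) (r%:C)%C ^+ k *: A k x.

Let y0 : y 0%N = a0 *: x.
Proof. by rewrite /y big_ord_recl big_ord0 addr0 subnn A0E scale1r. Qed.

Let yS k : y k.+1 = (r%:C)%C *: y k + (A k.+1 x + A k x).
Proof.
rewrite /y big_ord_recl/= subn0 scale1r.
(* The weights satisfy [w i.+1 = r * w i] except for [w 1 = r * w 0 + 1], which accounts for the
   extra term [A k x]. *)
rewrite (_ : \sum_(i < k.+1) A (k.+1 - bump 0 i)%N _ =
   A k x + (r%:C)%C *: \sum_(i < k.+1) A (k - i)%N ((w i)%:C%C *: x)).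
  by rewrite addrA addrC.
rewrite scaler_sumr big_ord_recl [in RHS]big_ord_recl /=.
rewrite /bump/= addn0 subSS subn0 scale1r add0n expr0 mulr1 rmorphD scalerDl scale1r.
rewrite linearD linearZ/= addrA; congr (_ + _).
apply: eq_bigr => i _; rewrite !add1n subSS -linearZ scalerA -rmorphM/=.
by congr (A _ (_%:C%C *: _)); rewrite exprS mulrCA.
Qed.

(* The identity (1 - r l) Y(l) = (1 + l) g(l) x between generating functions,
   truncated at order [m] and evaluated at l = r. *)
Let S_rec m :
  (r * (1 - r ^+ 2))%:C%C *: S m + (r ^+ m.+2)%:C%C *: y m + a0 *: x =
  (r ^+ 2)%:C%C *: y 0%N + g m.+1 + r%:C%C *: g m.
Proof.
elim: m => [|m IH].
  rewrite /S /g big_ord_recl !big_ord0/= !scaler0 expr0 scale1r A0E.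
  by rewrite ?addr0 ?add0r.
rewrite /S big_ord_recr/= -/(S m) scalerDr.
rewrite [g m.+2]big_ord_recr [in RHS]/g big_ord_recr/= -/(g m) -/(g m.+1).
(* The two coefficients on the left add up to [r ^+ m.+1], so this is a multiple of [yS m]. *)
have key : (r * (1 - r ^+ 2))%:C%C *: (r%:C%C ^+ m *: y m.+1) +
   (r ^+ m.+3)%:C%C *: y m.+1 =
  (r ^+ m.+2)%:C%C *: y m + (r%:C%C ^+ m.+1 *: A m.+1 x + r%:C%C ^+ m.+1 *: A m x).
  rewrite scalerA -scalerDl -rmorphXn -rmorphM -rmorphD/=.
  rewrite (_ : _ + _ = r ^+ m.+1); last by rewrite !exprS; ring.
  by rewrite yS scalerDr scalerA -rmorphM/= -exprSr scalerDr !rmorphXn. 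
rewrite -[_ + _ + (r ^+ m.+3)%:C%C *: _]addrA key scalerDr scalerA -exprS.
rewrite !addrA (ACl (1*2*5*3*4))/= IH (ACl (1*2*4*3*5))/=.
by rewrite [in LHS]/g big_ord_recr !addrA.
Qed.

Let K := 2 / (1 - r).

Let K0 : 0 <= K.
Proof. by rewrite divr_ge0// subr_ge0 ltW. Qed.

Let y_sum m : \sum_(k < m) rnorm (y k) ^+ 2 <= rnorm x ^+ 2 * K.
Proof.
apply: (le_trans (toepA (fun i => (w i)%:C%C *: x) m)).
rewrite (_ : \sum_(i < m) _ = rnorm x ^+ 2 * \sum_(i < m) w i ^+ 2).
  by rewrite ler_wpM2l ?w_sum// exprn_ge0// rnorm_ge0.
rewrite mulr_sumr; apply: eq_bigr => i _.
by rewrite rnormZ rnormCR exprMn real_normK ?num_real// mulrC.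
Qed.

(** A crude bound from [K >= 1]; its uniformity in [m] makes the remainder [r ^+ m.+2] times [y m]
    vanish in the limit. *)
Let y_le m : rnorm (y m) <= K * rnorm x.
Proof.
have Kx0 : 0 <= K * rnorm x by exact: (mulr_ge0 K0 (rnorm_ge0 _)).
rewrite -(@ler_pXn2r _ 2) ?nnegrE ?rnorm_ge0//.
have le : rnorm (y m) ^+ 2 <= rnorm x ^+ 2 * K.
  apply: le_trans (y_sum m.+1); rewrite big_ord_recr/= lerDr.
  by apply: sumr_ge0 => i _; rewrite exprn_ge0// rnorm_ge0.
apply: (le_trans le); rewrite exprMn mulrC ler_wpM2r// ?exprn_ge0 ?rnorm_ge0//.
rewrite expr2 ler_peMl// /K ler_pdivlMr ?subr_gt0//.
by have := r0; lra.
Qed.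

(** Cauchy-Schwarz in the form [2 |x| |w k| |y k| <= |x|^2 |w k|^2 + |y k|^2], where both sums on
    the right are at most [K |x|^2]. Dividing by [|x|] requires [x] nonzero. *)
Let wy_sum m : rnorm (\sum_(k < m) (w k)%:C%C *: y k) <= K * rnorm x.
Proof.
have [x0|x0] := eqVneq x 0.
  rewrite big1 ?rnorm0 ?(mulr_ge0 K0) ?rnorm_ge0// => k _.
  by rewrite /y big1 ?scaler0// => i _; rewrite x0 scaler0 linear0.
have n0 : 0 < rnorm x by rewrite lt_neqAle eq_sym rnorm_eq0 x0 rnorm_ge0.
rewrite (le_trans (rnorm_sum _ _ _))// -(ler_pM2l n0) mulr_sumr.
apply: (@le_trans _ _ (\sum_(k < m) (rnorm x ^+ 2 * w k ^+ 2 + rnorm (y k) ^+ 2) / 2)).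
  apply: ler_sum => k _; rewrite rnormZ rnormCR.
  have -> : w k ^+ 2 = `|w k| ^+ 2 by rewrite real_normK ?num_real.
  have := sqr_ge0 (rnorm x * `|w k| - rnorm (y k)); nra.
rewrite -mulr_suml big_split/= -mulr_sumr ler_pdivrMr//.
have := ler_wpM2l (exprn_ge0 2 (ltW n0)) (w_sum m); have := y_sum m.
by rewrite -/K; lra.
Qed.

Let g_cvg : g @ \oo --> G x.
Proof.
move/cvg_rnormP: GE => GE'.
apply: (@cvg_rnorm_squeeze _ _ _ _ (fun n => rnorm
   (series (fun k => r%:C%C ^+ k *: A k) n - G) * rnorm x)); last first.
  by rewrite -(mul0r (rnorm x)); apply: cvgMl.
move=> n; rewrite rnorm_bounded_op.
rewrite (_ : g n - G x = (series (fun k => r%:C%C ^+ k *: A k) n - G) x).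
  exact: rnorm_opnorm.
rewrite -[in RHS]scaleN1r bounded_opDE bounded_opZE scaleN1r; congr (_ - _).
by rewrite /series/= big_mkord bounded_op_sumE.
Qed.

(** By [S_rec] this vector is the limit of [r (1 - r)] times the sums bounded in [wy_sum], and
    [r (1 - r) K = 2 r]. *)
Lemma toeplitz_value_vec_le :
  rnorm ((1 + r)%:C%C *: G x - (1 - r)%:C%C *: (a0 *: x)) <= 2 * r * rnorm x.
Proof.
pose v m := (r * (1 - r))%:C%C *: \sum_(k < m.+1) (w k)%:C%C *: y k.
have vE m : v m = g m.+1 + r%:C%C *: g m - (1 - r)%:C%C *: (a0 *: x)
    - (r ^+ m.+2)%:C%C *: y m.
  rewrite /v big_ord_recl/= scale1r.
  under eq_bigr do rewrite /bump/= add1n rmorphM/= -scalerA rmorphXn.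
  rewrite -scaler_sumr -/(S m) scalerDr [_ *: (_ *: S m)]scalerA -rmorphM/=.
  (* The factor [1 + r] carried by every weight of positive index produces the coefficient of [S m]
     in [S_rec]. *)
  rewrite (_ : r * (1 - r) * (1 + r) = r * (1 - r ^+ 2)); last by ring.
  have -> : (r * (1 - r ^+ 2))%:C%C *: S m = (r ^+ 2)%:C%C *: y 0%N + g m.+1 +
      r%:C%C *: g m - a0 *: x - (r ^+ m.+2)%:C%C *: y m.
    by rewrite -S_rec addrK addrK.
  rewrite y0 !addrA (ACl (1*2*5*3*4*6))/= [RHS](ACl (3*1*2*4))/=.
  congr (_ + _ + _ + _); rewrite -scalerDl -rmorphD/= -[X in _ - X]scale1r.
  rewrite -scalerBl -(rmorph1 (real_complex R)) -rmorphB -scaleNr -rmorphN/=.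
  by congr (_%:C%C *: _); ring.
have v_cvg : v @ \oo --> (1 + r)%:C%C *: G x - (1 - r)%:C%C *: (a0 *: x).
  rewrite (funext vE) -[X in _ --> X]subr0; apply: cvgB; last first.
    apply: (@cvg_rnorm_squeeze _ _ _ _ (fun m => r ^+ 2 * r ^+ m * (K * rnorm x))).
      move=> n; rewrite subr0 rnormZ rnormCR ger0_norm ?exprn_ge0 ?(ltW r0)// -exprD add2n.
      by rewrite ler_wpM2l// exprn_ge0// ltW.
    rewrite -(mul0r (K * rnorm x)); apply: cvgMl; rewrite -(mulr0 (r ^+ 2)).
    by apply: cvgMr; apply: cvg_expr; rewrite ger0_norm// ltW.
  apply: cvgB; last exact: cvg_cst.
  rewrite rmorphD scalerDl scale1r; apply: cvgD; last exact: cvgZr.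
  by rewrite (cvg_shiftS g).
apply: (rnorm_cvg_le v_cvg); near=> m.
have rr0 : 0 <= r * (1 - r) by rewrite mulr_ge0 ?subr_ge0 ?ltW.
rewrite rnormZ rnormCR ger0_norm//.
apply: (le_trans (ler_wpM2l rr0 (wy_sum _))).
rewrite /K le_eqVlt; apply/orP; left; apply/eqP; field.
by rewrite gt_eqF// subr_gt0.
Unshelve. all: by end_near. Qed.

End Vector.

(** The triangle inequality adds [(1 - r) |a0| |x|] to the previous bound; then divide by
    [1 + r]. *)
Lemma toeplitz_value_le :
  opnorm G <= 1 - (1 - rnorm a0) * ((1 - r) / (1 + r)).
Proof.
have p0 : 0 < 1 + r by rewrite addr_gt0.
have a00 := rnorm_ge0 a0.
have -> : 1 - (1 - rnorm a0) * ((1 - r) / (1 + r)) =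
    (2 * r + (1 - r) * rnorm a0) / (1 + r).
  by field; rewrite gt_eqF.
apply: opnorm_rnorm_le => [|x].
  by rewrite divr_ge0 ?addr_ge0 ?mulr_ge0 ?subr_ge0 ?(ltW r0) ?(ltW r1).
rewrite mulrAC ler_pdivlMr// mulrC.
have -> : (1 + r) * rnorm (G x) = rnorm ((1 + r)%:C%C *: G x).
  by rewrite rnormZ rnormCR ger0_norm ?ltW.
rewrite -[_ *: _](subrK ((1 - r)%:C%C *: (a0 *: x))) (le_trans (rnormD _ _))//.
rewrite mulrDl; apply: lerD; first exact: toeplitz_value_vec_le.
by rewrite !rnormZ rnormCR ger0_norm ?subr_ge0 ?(ltW r1)// mulrA.
Qed.

End ToeplitzConsequences.

(** * The Bohr inequality *)

Section RealInequalities.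
Context {R : realType}.
Implicit Types p t r : R.

(** Combines [exp u >= 1 + u] at [u = p ln t] with [ln t >= 1 - 1 / t]. *)
Lemma powR_ge_ln_tangent p t : 0 < p -> 0 < t -> 1 - p * ((1 - t) / t) <= t `^ p.
Proof.
move=> p0 t0; rewrite /powR gt_eqF//; apply: le_trans (expR_ge1Dx _).
rewrite lerD2l -mulrN ler_wpM2l ?(ltW p0)//.
have := @le_ln1Dx R (t^-1 - 1); rewrite addrCA subrr addr0 lnV ?posrE//.
have -> : (1 - t) / t = t^-1 - 1 by rewrite mulrBl mul1r divff ?gt_eqF.
by rewrite ltrBrDl subrr invr_gt0 => /(_ t0); lra.
Qed.

(** Convexity of the exponential between [ln t] and 0, with weights [p] and [1 - p]; [t = 0] is
    treated apart. *)
Lemma powR_le_tangent p t : 0 < p <= 1 -> 0 <= t -> t `^ p <= 1 - p * (1 - t).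
Proof.
move=> /andP[p0 p1]; rewrite le_eqVlt => /predU1P[<-|t0].
  by rewrite powR0 ?gt_eqF// subr0 mulr1 subr_ge0.
have := @convex_expR R (Itv01 (ltW p0) p1) (ln t : R^o) (0 : R^o).
rewrite !convRE/= mulr0 addr0 lnK ?posrE// expR0 mulr1 /unstable.onem.
by rewrite /powR gt_eqF//; lra.
Qed.

Definition bohr_fun p N r := 2 * (1 + r) * r ^+ N - p * (1 - r) ^+ 2.

Lemma bohr_fun_increasing p N r s : 0 < p -> 0 <= r -> r < s -> s <= 1 ->
  bohr_fun p N r < bohr_fun p N s.
Proof.
move=> p0 r0 rs s1; rewrite /bohr_fun.
have rsN : r ^+ N <= s ^+ N by rewrite lerXn2r ?nnegrE//; lra.
have sN0 : 0 <= r ^+ N by rewrite exprn_ge0.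
have h1 : (1 + r) * r ^+ N <= (1 + s) * s ^+ N by nra.
have h2 : p * (1 - s) ^+ 2 < p * (1 - r) ^+ 2.
  by rewrite ltr_pM2l// ltrXn2r// ?nnegrE; lra.
lra.
Qed.

(** The polynomial is [- p] at 0 and 4 at 1, and [bohr_fun] is strictly increasing in between. *)
Lemma bohr_radius_unique p N : 0 < p -> (0 < N)%N ->
  exists r, unique (bohr_radius_eq p N) r.
Proof.
move=> p0 N0.
pose F : {poly R} := 2%:P * (1 + 'X) * 'X^N - p%:P * (1 - 'X) ^+ 2.
have FE r : F.[r] = bohr_fun p N r by rewrite /F !hornerE /bohr_fun expr2 mulrA.
have F0 : F.[0] < 0.
  by rewrite FE /bohr_fun expr0n gtn_eqF// mulr0 add0r subr0 expr1n mulr1 oppr_lt0.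
have F1 : 0 < F.[1].
  by rewrite FE /bohr_fun subrr !expr1n expr0n mulr0 subr0 mulr1; lra.
have F01 : F.[0] <= 0 <= F.[1] by rewrite !ltW.
have [r /andP[r0 r1] /rootP Fr] := poly_ivt ler01 F01.
have r0' : 0 < r.
  by rewrite lt_neqAle r0 andbT; apply/eqP => r0E; move: F0; rewrite [in F.[_]]r0E Fr ltxx.
have r1' : r < 1.
  by rewrite lt_neqAle r1 andbT; apply/eqP => r1E; move: F1; rewrite -r1E Fr ltxx.
exists r; split; first by split; [rewrite r0' r1'|rewrite -Fr FE].
move=> s [/andP[s0 s1]]; rewrite -/(bohr_fun p N s) => Fs.
have [rs|sr|//] := ltgtP r s.
  by have := bohr_fun_increasing N p0 r0 rs (ltW s1); rewrite Fs -FE Fr ltxx.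
by have := bohr_fun_increasing N p0 (ltW s0) sr r1; rewrite Fs -FE Fr ltxx.
Qed.

Lemma bohr_sum_le1 p N r al t (e : nat -> R) : 0 < p <= 1 -> 0 < r < 1 ->
  2 * (1 + r) * r ^+ N - p * (1 - r) ^+ 2 = 0 -> 0 <= al < 1 ->
  0 <= t -> t <= 1 - (1 - al) * ((1 - r) / (1 + r)) ->
  (forall k, 0 <= e k) ->
  (forall k, (N <= k)%N -> e k <= (1 - al ^+ 2) * r ^+ k) ->
  ((t `^ p)%:E + \sum_(N <= k <oo) (e k)%:E <= 1)%E.
Proof.
move=> p01 /andP[r0 r1] Fr /andP[al0 al1] t0 tle e0 ele.
have [p0 p1] := andP p01.
have d0 : 0 < 1 - r by rewrite subr_gt0.
have d1 : 0 < 1 + r by rewrite addr_gt0.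
have al2 : 0 <= 1 - al ^+ 2 by rewrite subr_ge0 expr_le1// ltW.
have sum_le : (\sum_(N <= k <oo) (e k)%:E <= ((1 - al ^+ 2) * (r ^+ N / (1 - r)))%:E)%E.
  apply: lime_le; first by apply: is_cvg_nneseries => k _ _; rewrite lee_fin.
  near=> m; rewrite sumEFin lee_fin.
  have r01 : 0 <= r < 1 by rewrite ltW.
  apply: le_trans (ler_wpM2l al2 (sum_geometric_le N m r01)).
  rewrite mulr_sumr big_nat_cond [leRHS]big_nat_cond.
  by apply: ler_sum => k /andP[/andP[Nk _] _]; exact: ele.
apply: (@le_trans _ _ ((t `^ p)%:E + ((1 - al ^+ 2) * (r ^+ N / (1 - r)))%:E)%E).
  by rewrite leeD2l.
rewrite -EFinD lee_fin; have := powR_le_tangent p01 t0.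
set u := (1 - r) / (1 + r) in tle.
(* The radius equation makes the tail [(1 - al^2) p u / 2], at most the gain [p (1 - al) u] of the
   tangent bound because [1 + al <= 2]. *)
have -> : r ^+ N / (1 - r) = p * u / 2.
  rewrite /u; have -> : r ^+ N = p * (1 - r) ^+ 2 / (2 * (1 + r)).
    apply: (mulIf (lt0r_neq0 (mulr_gt0 (ltr0Sn R 1) d1))).
    by rewrite divfK ?mulf_neq0 ?gt_eqF//; lra.
  by field; rewrite !gt_eqF.
have u0 : 0 <= u by rewrite divr_ge0// ltW.
have pt : p * ((1 - al) * u) <= p * (1 - t) by rewrite ler_wpM2l ?(ltW p0)//; lra.
have : (1 - al ^+ 2) * (p * u / 2) <= p * ((1 - al) * u).
  have -> : (1 - al ^+ 2) * (p * u / 2) = (p * ((1 - al) * u)) * ((1 + al) / 2) by field.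
  have al10 : 0 <= 1 - al by rewrite subr_ge0 ltW.
  rewrite ler_piMr//; first exact: mulr_ge0 (ltW p0) (mulr_ge0 al10 u0).
  by rewrite ler_pdivrMr//; lra.
lra.
Unshelve. all: by end_near. Qed.

End RealInequalities.

(** * Homogeneous expansions and their disc slices *)

Section HomogeneousPoly.
Context {R : realType} {n : nat}.

Lemma homogeneous_polyZ (V : lmodType R[i]) k (P : 'rV[R[i]]_n -> V) w z :
  homogeneous_poly k P -> P (w *: z) = w ^+ k *: P z.
Proof.
move=> [A PE]; rewrite !PE scaler_sumr; apply: eq_bigr => al /eqP alk.
rewrite scalerA; congr (_ *: _).
rewrite (_ : w ^+ k = w ^+ (\sum_j al j)); last by rewrite alk.
by rewrite expr_sum -big_split/=; apply: eq_bigr => j _; rewrite mxE exprMn.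
Qed.

Lemma open_shift (Q : set 'rV[R[i]]_n) z v : open Q -> Q z ->
  exists2 t : R, 0 < t & Q (z + t%:C%C *: v).
Proof.
move=> Qo Qz.
have uz : (fun k => z + (k.+1%:R^-1 : R)%:C%C *: v) @ \oo --> z.
  rewrite -[X in _ --> X]addr0 -(scale0r v); apply: cvgD; first exact: cvg_cst.
  apply: cvgZl; apply: (@cvg_rnorm_squeeze _ R[i] _ _ (fun k => k.+1%:R^-1)).
    by move=> k; rewrite subr0 rnormCR ger0_norm.
  exact: cvg_harmonic.
have [k _ /(_ k (leqnn _)) Qk] := uz _ (open_nbhs_nbhs (conj Qo Qz)).
by exists (k.+1%:R^-1).
Qed.

End HomogeneousPoly.

Section DiscSlice.
Context {R : realType} {n : nat} {V : normedModType R[i]}.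
Variables (Q : set 'rV[R[i]]_n) (Qcirc : complete_circular_domain Q).
Variables (f : 'rV[R[i]]_n -> V) (P : nat -> 'rV[R[i]]_n -> V).
Hypothesis fP : homogeneous_expansion Q f P.

Lemma slice_cvg z (w : R[i]) : Q z -> rnorm w <= 1 ->
  series (fun k => w ^+ k *: P k z) @ \oo --> f (w *: z).
Proof.
case: fP Qcirc => homP cvgP [_ _ _ circQ] Qz w1.
have Qwz : Q (w *: z) by apply: circQ => //; move: w1; rewrite rnorm_le.
rewrite (_ : (fun k => _) = (fun k => P k (w *: z))); first exact: cvgP.
by apply/funext => k; rewrite (homogeneous_polyZ _ _ (homP k)).
Qed.

(** In the slice at [w = 0] every term of positive degree vanishes. *)
Lemma expansion_constant_term z : Q z -> P 0%N z = f 0.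
Proof.
move=> Qz; apply/eqP; rewrite -subr_eq0 -rnorm_eq0 eq_le rnorm_ge0 andbT.
have := @slice_cvg z 0 Qz; rewrite rnorm0 scale0r => /(_ ler01) fz.
apply: (rnorm_cvg_le (cvgB (cvg_cst (P 0%N z)) fz)); near=> m.
have m0 : (0 < m)%N by near: m; exact: nbhs_infty_gt.
rewrite -[X in rnorm X]/(P 0%N z - series _ m) /series/= -(prednK m0).
rewrite big_nat_recl// big1 ?addr0 => [|i _]; last first.
  by rewrite exprS mul0r scale0r.
by rewrite expr0 scale1r subrr rnorm0.
Unshelve. all: by end_near. Qed.

(** Openness puts [(1 + t) z] in [Q] for some [t > 0]. The terms of the convergent series there are
    bounded, and homogeneity scales them back by [(1 + t)^-k]. *)
Lemma slice_geometric_decay z : Q z -> exists c q : R,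
  0 <= q < 1 /\ forall k, rnorm (P k z) <= c * q ^+ k.
Proof.
case: fP Qcirc => homP cvgP [openQ _ _ _] Qz.
have [t t0 Qtz] := open_shift z openQ Qz.
have t1 : 0 < 1 + t by rewrite addr_gt0.
have Qtz' : Q ((1 + t)%:C%C *: z) by rewrite rmorphD scalerDl scale1r.
have /cvg_rnormP Pcvg : (fun k => P k ((1 + t)%:C%C *: z)) @ \oo --> (0 : V).
  have h := cvgP _ Qtz'; rewrite -(subrr (f ((1 + t)%:C%C *: z))).
  rewrite (_ : (fun k => _) = (fun k => series (P ^~ ((1 + t)%:C%C *: z)) k.+1 -
      series (P ^~ ((1 + t)%:C%C *: z)) k)).
    by apply: cvgB => //; rewrite (cvg_shiftS (series _)).
  by apply/funext => k; rewrite seriesSB.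
have /cvg_seq_bounded/pinfty_ex_gt0[c _ cP] :
    cvgn (fun k => rnorm (P k ((1 + t)%:C%C *: z) - 0)).
  by apply/cvg_ex; exists 0.
exists c, (1 + t)^-1; split.
  by rewrite invr_ge0 ltW//= invf_lt1// ltrDl.
move=> k; rewrite exprVn ler_pdivlMr ?exprn_gt0// mulrC.
have := cP k I; rewrite /= subr0 ger0_norm ?rnorm_ge0// (homogeneous_polyZ _ _ (homP k)).
by rewrite rnormZ -rmorphXn rnormCR ger0_norm// exprn_ge0// ltW.
Qed.

End DiscSlice.

Lemma bohr_inequality_dilation (R : realType) (H : normedModType R[i])
    (dot : {dot H for Num.conj}) (dotE : forall u : H, dot u u = `|u| ^+ 2)
    (n : nat) (Q : set 'rV[R[i]]_n) (Qcirc : complete_circular_domain Q)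
    (p : R) (p01 : 0 < p <= 1) (N : nat) (N1 : (1 <= N)%N) (r : R)
    (rE : bohr_radius_eq p N r) (f : 'rV[R[i]]_n -> bounded_op H)
    (P : nat -> 'rV[R[i]]_n -> bounded_op H) :
  bohr_admissible Q f P ->
  forall z, dilation r Q z -> bohr_inequality p N f P z.
Proof.
move=> [fP f1 [a0 a01 f0]] _ [z Qz <-].
have [r01 Fr] := rE.
have [c [q [q01 Pq]]] := slice_geometric_decay Qcirc fP Qz.
have rr : `|r%:C%C| <= 1 :> R[i].
  by rewrite rnormE rnormCR lecR ger0_norm ltW//; case/andP: r01.
have toepP := toeplitz_contraction dotE q01 Pq
  (fun w => @slice_cvg _ _ _ _ Qcirc _ _ fP z w Qz).
have {}toepP : forall (x : nat -> H) m,
  \sum_(k < m) rnorm (\sum_(i < k.+1) P (k - i)%N z (x i)) ^+ 2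
    <= \sum_(i < m) rnorm (x i) ^+ 2.
  apply: toepP => w w1; apply/ltW/f1.
  by case: Qcirc => _ _ _; apply => //; rewrite -[1]/(1%:C%C) -rnorm_le.
have P0 : P 0%N z = a0 *: id_op H by rewrite (expansion_constant_term Qcirc fP Qz).
have a01' : rnorm (a0 : R[i]) < 1 by rewrite -ltcR -rnormE.
have rr1 : rnorm (r%:C%C : R[i]) <= 1 by rewrite rnorm_le.
apply: (@bohr_sum_le1 _ p N r (rnorm (a0 : R[i]))) => //.
- by rewrite rnorm_ge0.
- exact: opnorm_ge0.
- exact: (toeplitz_value_le toepP P0 r01 (slice_cvg Qcirc fP Qz rr1)).
- by move=> k; exact: opnorm_ge0.
move=> k Nk; case: fP => homP _; rewrite (homogeneous_polyZ _ _ (homP k)).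
rewrite -rnorm_bounded_op rnormZ -rmorphXn rnormCR ger0_norm ?exprn_ge0//; last first.
  by apply/ltW; case/andP: r01.
rewrite mulrC ler_wpM2r// ?exprn_ge0//; first by apply/ltW; case/andP: r01.
(* The coefficient bound concerns positive degrees only; [N >= 1] excludes [k = 0]. *)
case: k Nk => [N0|k _]; first by have := leq_trans N1 N0.
exact: (@toeplitz_coef_le _ _ (fun k => P k z) _ toepP P0 a01').
Qed.

(** * Sharpness *)

Section HahnBanach.
Context {R : realType} {V : lmodType R[i]}.
Variables (Q : set V).
Hypothesis convQ : forall x y (t : R), Q x -> Q y -> 0 <= t <= 1 ->
  Q (t%:C%C *: x + (1 - t)%:C%C *: y).
Hypothesis absQ : forall x, exists2 t : R, 0 < t & Q (t%:C%C *: x).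

(* [al] lists the values on [v] of a real functional that is 1 at [w] and at most 1
   on [Q]; as [s] need not be independent of [w], no functional is named. *)
Lemma hahn_banach_seq (w : V) (I : eqType) (v : I -> V) (s : seq I) :
  ~ Q w -> uniq s ->
  exists al : I -> R, forall (c : R) (t : I -> R),
    Q (c%:C%C *: w + \sum_(i <- s) (t i)%:C%C *: v i) ->
    c + \sum_(i <- s) t i * al i <= 1.
Proof.
move=> Qw.
have Q0 : Q 0 by have [t _] := absQ 0; rewrite scaler0.
elim: s => [_|x s IH /andP[xs us]].
  (* If [c > 1], shrinking [c w] towards the point 0 of [Q] would put [w] in [Q]. *)
  exists (fun=> 0) => c t; rewrite !big_nil !addr0 => Qcw.
  rewrite leNgt; apply/negP => c1; apply: Qw.
  have c0 : 0 < c by rewrite (lt_trans ltr01).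
  have := @convQ _ 0 c^-1 Qcw Q0; rewrite scaler0 addr0 scalerA -rmorphM/=.
  by rewrite mulVf ?gt_eqF// scale1r; apply; rewrite invr_ge0 ltW//= invf_le1// ltW.
have [al alQ] := IH us.
pose U c (t : I -> R) : V := c%:C%C *: w + \sum_(i <- s) (t i)%:C%C *: v i.
pose phi c (t : I -> R) : R := c + \sum_(i <- s) t i * al i.
have UD a b c1 c2 t1 t2 : a%:C%C *: U c1 t1 + b%:C%C *: U c2 t2 =
    U (a * c1 + b * c2) (fun i => a * t1 i + b * t2 i).
  rewrite /U !scalerDr !scalerA addrACA -!rmorphM/= -scalerDl -rmorphD; congr (_ + _).
  rewrite !scaler_sumr -big_split/=; apply: eq_bigr => i _.
  by rewrite !scalerA -!rmorphM/= -scalerDl -rmorphD.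
have phiD a b c1 c2 t1 t2 : phi (a * c1 + b * c2) (fun i => a * t1 i + b * t2 i) =
    a * phi c1 t1 + b * phi c2 t2.
  rewrite /phi !mulrDr !mulr_sumr addrACA; congr (_ + _).
  by rewrite -big_split/=; apply: eq_bigr => i _; rewrite mulrDl !mulrA.
(* The convex combination with weights proportional to [s2] and [s1] cancels [v x], so the induction
   hypothesis applies to it. *)
have sep c1 t1 s1 c2 t2 s2 : 0 < s1 -> 0 < s2 ->
    Q (U c1 t1 - s1%:C%C *: v x) -> Q (U c2 t2 + s2%:C%C *: v x) ->
    (phi c1 t1 - 1) / s1 <= (1 - phi c2 t2) / s2.
  move=> s10 s20 Q1 Q2; have s0 : 0 < s1 + s2 by rewrite addr_gt0.
  have l01 : 0 <= s2 / (s1 + s2) <= 1.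
    by rewrite divr_ge0 ?(ltW s20) ?(ltW s0)//= ler_pdivrMr// mul1r lerDr ltW.
  have lE : 1 - s2 / (s1 + s2) = s1 / (s1 + s2) by field; rewrite gt_eqF.
  have := convQ Q1 Q2 l01; rewrite lE scalerDr [in X in _ + X]scalerDr addrACA UD.
  rewrite scalerN !scalerA -!rmorphM/= addrC.
  rewrite (_ : s1 / (s1 + s2) * s2 = s2 / (s1 + s2) * s1); last by ring.
  rewrite addNr add0r => /alQ; rewrite -/(phi _ _) phiD => le.
  rewrite ler_pdivrMr// mulrAC ler_pdivlMr//.
  move: (phi c1 t1) (phi c2 t2) le => A B.
  rewrite (_ : _ + _ = (s2 * A + s1 * B) / (s1 + s2)); last by ring.
  by rewrite ler_pdivrMr//; lra.
(* The lower bounds that points with a negative coefficient of [v x] impose on its value. By [sep]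
   they lie below the upper bounds from positive coefficients, so the value [sup L] respects
   both. *)
pose L := [set y | exists c t s1, [/\ 0 < s1, Q (U c t - s1%:C%C *: v x) &
  y = (phi c t - 1) / s1]].
have U0 : U 0 (fun=> 0) = 0.
  by rewrite /U scale0r big1 ?addr0// => i _; rewrite scale0r.
have L0 : L !=set0.
  have [s1 s10 Qs] := absQ (- v x).
  exists ((phi 0 (fun=> 0) - 1) / s1), 0, (fun=> 0), s1; split => //.
  by rewrite U0 add0r -scalerN.
have Lub c t s2 : 0 < s2 -> Q (U c t + s2%:C%C *: v x) -> ubound L ((1 - phi c t) / s2).
  by move=> s20 Q2 _ [c1 [t1 [s1 [s10 Q1 ->]]]]; exact: sep.
have Lhub : has_ubound L.
  have [s2 s20 Qs] := absQ (v x).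
  exists ((1 - phi 0 (fun=> 0)) / s2); apply: Lub => //.
  by rewrite U0 add0r.
exists (fun i => if i == x then sup L else al i) => c t.
(* As [x] is not in [s], the new value leaves the old terms unchanged. *)
have eqs (F : I -> R -> R) : \sum_(i <- s) F i (if i == x then sup L else al i) =
    \sum_(i <- s) F i (al i).
  rewrite big_seq [RHS]big_seq; apply: eq_bigr => i si.
  by case: eqP => // ix; rewrite ix (negbTE xs) in si.
rewrite !big_cons eqxx (eqs (fun i y => t i * y)).
rewrite [_%:C%C *: v x + _]addrC addrA -/(U c t).
rewrite [t x * _ + _]addrC addrA -/(phi c t).
have [tx|tx|tx] := ltgtP (t x) 0.
- rewrite -[t x]opprK rmorphN scaleNr => Qt; rewrite mulNr.
  have tx0 : 0 < - t x by rewrite oppr_gt0.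
  have : (phi c t - 1) / (- t x) <= sup L.
    by apply: ub_le_sup => //; exists c, t, (- t x).
  by rewrite ler_pdivrMr//; lra.
- move=> /(Lub _ _ _ tx)/(ge_sup L0); rewrite ler_pdivlMr//; lra.
- by rewrite tx scale0r addr0 mul0r addr0; exact: alQ.
Qed.

End HahnBanach.

(** * Supporting linear forms of a convex circular domain *)

Section SupportingFunctional.
Context {R : realType} {n : nat}.
Variables (Q : set 'rV[R[i]]_n) (Qcirc : complete_circular_domain Q).
Hypothesis convQ : convex_set (Q : set (convex_lmodType 'rV[R[i]]_n)).

Definition linear_form (c : 'I_n -> R[i]) (z : 'rV[R[i]]_n) : R[i] :=
  \sum_j z 0 j * c j.

Lemma linear_formZ c a z : linear_form c (a *: z) = a * linear_form c z.
Proof.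
by rewrite /linear_form mulr_sumr; apply: eq_bigr => j _; rewrite mxE mulrA.
Qed.

Lemma convex_set_segment x y (t : R) : Q x -> Q y -> 0 <= t <= 1 ->
  Q (t%:C%C *: x + (1 - t)%:C%C *: y).
Proof.
move=> Qx Qy /andP[t0 t1].
have t0C : 0 <= (t%:C%C : R[i]) by rewrite ler0c.
have t1C : (t%:C%C : R[i]) <= 1 by rewrite -[1]/(1%:C%C) lecR.
have := convQ (Itv01 t0C t1C) (mem_set Qx) (mem_set Qy).
by rewrite inE rmorphB.
Qed.

Lemma open_absorbing x : exists2 t : R, 0 < t & Q (t%:C%C *: x).
Proof.
case: Qcirc => openQ _ Q0 _; have [t t0] := open_shift x openQ Q0.
by rewrite add0r; exists t.
Qed.

Lemma rotate_nonneg (x : R[i]) : exists2 xi : R[i], `|xi| = 1 & xi * x = `|x|.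
Proof.
have [->|x0] := eqVneq x 0; first by exists 1; rewrite ?normr1// mulr0 normr0.
exists (`|x| / x); first by rewrite normf_div normr_id divff// normr_eq0.
by rewrite divfK.
Qed.

(** Hahn-Banach at a point outside [Q] bounds the real part of the form; a rotation, under which [Q]
    is stable, turns the real part into the modulus. *)
Lemma linear_form_bounded : Q <> setT ->
  exists c, (forall z, Q z -> rnorm (linear_form c z) <= 1) /\
    exists w, linear_form c w != 0.
Proof.
move=> QT.
have [w Qw] : exists w, ~ Q w.
  by apply/not_existsP => Qw; apply: QT; apply/seteqP; split=> // z _; exact: contrapT.
(* A real basis of the space: the unit vectors and their multiples by the imaginary unit. *)
pose v (i : 'I_n * bool) : 'rV[R[i]]_n :=
  (if i.2 then 'i%C else 1) *: delta_mx 0 i.1.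
have [al alP] := hahn_banach_seq convex_set_segment open_absorbing v Qw
  (index_enum_uniq ('I_n * bool)%type).
pose t (z : 'rV[R[i]]_n) (i : 'I_n * bool) : R :=
  if i.2 then complex.Im (z 0 i.1 : R[i]) else complex.Re (z 0 i.1 : R[i]).
(* Complexification: the functional [al] becomes the real part of [linear_form c]. *)
pose c j : R[i] := (al (j, false))%:C%C - 'i%C * (al (j, true))%:C%C.
have tE (z : 'rV[R[i]]_n) : \sum_i (t z i)%:C%C *: v i = z.
  rewrite -(pair_bigA _ (fun j b => (t z (j, b))%:C%C *: v (j, b)))/=.
  rewrite [RHS]row_sum_delta; apply: eq_bigr => j _.
  rewrite big_bool/= /t /v/= !scalerA -scalerDl mulr1; congr (_ *: _).
  by rewrite addrC mulrC; case: (z 0 j) => a b; simpc.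
have phiE (z : 'rV[R[i]]_n) : \sum_i t z i * al i =
    complex.Re (linear_form c z).
  rewrite (eq_bigr (fun i => t z (i.1, i.2) * al (i.1, i.2))); last by move=> [].
  rewrite -(pair_bigA _ (fun j b => t z (j, b) * al (j, b)))/=.
  rewrite raddf_sum; apply: eq_bigr => j _; rewrite big_bool/= /t/= /c.
  by case: (z 0 j) => a b; simpc => /=; ring.
have Re_le z : Q z -> complex.Re (linear_form c z) <= 1.
  move=> Qz; have := alP 0 (t z); rewrite scale0r add0r tE phiE add0r; exact.
exists c; split=> [z Qz|].
  have [xi xi1 xiE] := rotate_nonneg (linear_form c z).
  have /Re_le : Q (xi *: z) by case: Qcirc => _ _ _; apply=> //; rewrite xi1.
  by rewrite linear_formZ xiE.
exists w; apply/eqP => lw0.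
(* If the form vanished at [w], the decomposition [2 w - 2 w] of the point 0 of [Q] would give
   [2 <= 1]. *)
have := alP 2 (t (- 2%:C%C *: w)); rewrite tE phiE linear_formZ lw0 mulr0/= scaleNr subrr.
have Q0 : Q 0 by case: Qcirc.
by move=> /(_ Q0); lra.
Qed.

(** Dividing by the supremum of the modulus normalises it to 1. Since [Q] is open, each [z] can be
    stretched slightly within [Q], so the supremum is not attained; rotations make near-extremal
    values real. *)
Lemma supporting_linear_form : Q <> setT ->
  exists c, (forall z, Q z -> rnorm (linear_form c z) < 1) /\
    forall eta : R, eta < 1 -> exists2 z, Q z &
      exists2 x : R, eta < x & linear_form c z = x%:C%C.
Proof.
move=> /linear_form_bounded[c [c1 [w w0]]].
have [openQ _ Q0 circQ] := Qcirc.
pose L := [set rnorm (linear_form c z) | z in Q].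
have Lub : has_ubound L by exists 1 => _ [z Qz <-]; exact: c1.
have s0 : 0 < sup L.
  have [t t0 Qtw] := open_absorbing w.
  apply: (@lt_le_trans _ _ (rnorm (linear_form c (t%:C%C *: w)))); last first.
    by apply: ub_le_sup => //; exists (t%:C%C *: w).
  rewrite lt_neqAle rnorm_ge0 andbT eq_sym rnorm_eq0 linear_formZ mulf_neq0//.
  by rewrite -(rmorph0 (real_complex R)) (inj_eq (@complexI R)) gt_eqF.
pose c' j := (sup L)^-1%:C%C * c j.
have c'E z : linear_form c' z = (sup L)^-1%:C%C * linear_form c z.
  by rewrite /linear_form mulr_sumr; apply: eq_bigr => j _; rewrite mulrCA.
have rc'E z : rnorm (linear_form c' z) = (sup L)^-1 * rnorm (linear_form c z).
  by rewrite c'E (rnormZ _ (linear_form c z : R[i])) rnormCR ger0_norm// invr_ge0 ltW.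
have c'1 z : Q z -> rnorm (linear_form c' z) <= 1.
  move=> Qz; rewrite rc'E ler_pdivrMl// mulr1.
  by apply: ub_le_sup => //; exists z.
exists c'; split=> [z Qz|eta eta1].
  have [t t0 Qtz] := open_shift z openQ Qz.
  have := c'1 _ Qtz; rewrite -[X in X + _]scale1r -scalerDl -(rmorph1 (real_complex R)).
  rewrite -rmorphD linear_formZ (rnormZ _ (linear_form c' z : R[i])) rnormCR.
  have t1 : 0 < 1 + t by rewrite addr_gt0.
  rewrite ger0_norm ?(ltW t1)// => le.
  have := rnorm_ge0 (linear_form c' z : R[i]); nra.
have Lsup : has_sup L by split=> //; exists (rnorm (linear_form c 0)), 0.
have es : sup L * eta < sup L by rewrite gtr_pMr.
have [_ [z Qz <-] ez] := sup_gt Lsup.1 es.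
have [xi xi1 xiE] := rotate_nonneg (linear_form c' z).
exists (xi *: z); first by apply: circQ => //; rewrite xi1.
exists (rnorm (linear_form c' z)); last by rewrite linear_formZ xiE rnormE.
by rewrite rc'E ltr_pdivlMl.
Qed.

End SupportingFunctional.

Section LinearFormPowers.
Context {R : realType} {n : nat}.

(** Multinomial expansion: the power is a sum over words [g] of length [k], grouped by their letter
    counts [cnt g]. *)
Lemma homogeneous_poly_linear_form_exp (V : lmodType R[i]) k (c : 'I_n -> R[i]) (T : V) :
  homogeneous_poly k (fun z => linear_form c z ^+ k *: T).
Proof.
pose cnt (g : {ffun 'I_k -> 'I_n}) : {ffun 'I_n -> 'I_k.+1} :=
  [ffun j => inord #|[pred i | g i == j]|].
have cntE g j : cnt g j = #|[pred i | g i == j]| :> nat.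
  rewrite ffunE inordK// ltnS (leq_trans (max_card _))// card_ord//.
have cnt_sum g : (\sum_j cnt g j)%N = k.
  rewrite -[RHS]card_ord -sum1_card (partition_big (fun i => g i) xpredT)//=.
  by apply: eq_bigr => j _; rewrite cntE -sum1_card; apply: eq_bigl => i; rewrite !inE.
exists (fun a => (\sum_(g : {ffun 'I_k -> 'I_n} | [ffun j => cnt g j : nat] == a)
    \prod_i c (g i)) *: T) => z.
under [RHS]eq_bigr do rewrite scalerA.
rewrite -scaler_suml; congr (_ *: _).
rewrite /linear_form -[X in _ ^+ X]card_ord -prodr_const.
rewrite bigA_distr_bigA/=.
rewrite (partition_big cnt (fun al => \sum_j al j == k)%N)/=; last first.
  by move=> g _; rewrite cnt_sum.
apply: eq_bigr => al _; rewrite mulr_sumr; apply: eq_big => [g|g /eqP <-].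
  apply/eqP/eqP => [->//|/ffunP galE]; apply/ffunP => j; apply/val_inj.
  by have := galE j; rewrite !ffunE.
rewrite big_split/=; congr (_ * _).
rewrite (partition_big (fun i => g i) xpredT)//=; apply: eq_bigr => j _.
rewrite cntE -prodr_const; apply: eq_big => [i|i /eqP ->//].
by rewrite inE.
Qed.

End LinearFormPowers.

(** * A disc automorphism and its Taylor series *)

Section Moebius.
Context {R : realType}.
Variables (a : R) (a01 : 0 < a < 1).
Let a0 : 0 < a. Proof. by case/andP: a01. Qed.
Let a1 : a < 1. Proof. by case/andP: a01. Qed.

Definition moebius (x : R[i]) : R[i] := (a%:C%C + x) / (1 + a%:C%C * x).

(** The Taylor coefficients of [moebius] at 0. *)
Definition moebius_coef (k : nat) : R :=
  if k is j.+1 then (1 - a ^+ 2) * (- a) ^+ j else a.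

Let den_neq0 (x : R[i]) : rnorm x < 1 -> 1 + a%:C%C * x != 0.
Proof.
move=> x1; apply/eqP => /(congr1 (@rnorm R R[i])); rewrite rnorm0 => /eqP.
rewrite rnorm_eq0 addr_eq0 => /eqP /(congr1 (@rnorm R R[i])).
rewrite rnormN (rnormZ _ (x : R[i])) rnormCR -(rmorph1 (real_complex R)) rnormCR.
rewrite normr1 ger0_norm ?(ltW a0)// => ax.
have := rnorm_ge0 x; have := a0; have := a1; nra.
Qed.

(** From [|1 + a x|^2 - |a + x|^2 = (1 - a^2) (1 - |x|^2)]. *)
Lemma rnorm_moebius_lt1 (x : R[i]) : rnorm x < 1 -> rnorm (moebius x) < 1.
Proof.
move=> x1; have d0 := den_neq0 x1.
have sq (y : R[i]) : (rnorm y ^+ 2)%:C%C = y * y^*.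
  by rewrite rmorphXn/= -rnormE normCK.
have aconj : (a%:C%C : R[i])^* = a%:C%C by rewrite conj_Creal// complex_real.
have dn0 : 0 < rnorm (1 + a%:C%C * x : R[i]).
  by rewrite lt_neqAle eq_sym rnorm_eq0 d0 rnorm_ge0.
have -> : rnorm (moebius x) = rnorm (a%:C%C + x : R[i]) / rnorm (1 + a%:C%C * x : R[i]).
  by apply: (@complexI R); rewrite fmorph_div -!rnormE normf_div.
rewrite ltr_pdivrMr// mul1r -(@ltr_pXn2r _ 2) ?nnegrE ?rnorm_ge0// -ltcR !sq.
rewrite !rmorphD !rmorphM /= aconj rmorph1 -subr_gt0.
rewrite (_ : _ - _ = (1 - a%:C%C ^+ 2) * (1 - x * x^*)); last by ring.
rewrite -sq -!rmorphXn -(rmorph1 (real_complex R)) -!rmorphB -rmorphM ltcR.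
by rewrite mulr_gt0// subr_gt0 expr_lt1// ?rnorm_ge0// ltW.
Qed.

(** The remainder has the closed form [sE], geometric with ratio [- a x], hence dominated by a
    multiple of [a ^+ m]. *)
Lemma moebius_series_cvg (x : R[i]) : rnorm x < 1 ->
  series (fun k => (moebius_coef k)%:C%C * x ^+ k) @ \oo --> moebius x.
Proof.
move=> x1; have d0 := den_neq0 x1.
have sE m : series (fun k => (moebius_coef k)%:C%C * x ^+ k) m.+1 - moebius x =
    - ((1 - a ^+ 2)%:C%C * x / (1 + a%:C%C * x) * (- (a%:C%C * x)) ^+ m).
  elim: m => [|m IH].
    rewrite /series/= big_nat1 expr0 mulr1 /moebius rmorphB rmorph1 rmorphXn/=.
    by field.
  rewrite /series/= big_nat_recr//= addrAC -/(series _ _).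
  rewrite [X in X + _]IH /= rmorphM rmorphXn rmorphN [_ ^+ m.+1 in RHS]exprS.
  rewrite [x ^+ m.+1]exprS mulrACA -exprMn mulNr.
  move: (_ ^+ m) => Y; field.
  exact: d0.
rewrite -(cvg_shiftS (series _)).
pose C := rnorm ((1 - a ^+ 2)%:C%C * x / (1 + a%:C%C * x) : R[i]).
apply: (@cvg_rnorm_squeeze _ R[i] _ _ (fun m => C * a ^+ m)); last first.
  rewrite -(mulr0 C); apply: cvgMr; apply: cvg_expr.
  by rewrite ger0_norm ?(ltW a0).
move=> m; rewrite sE rnormN rnormZ -/C ler_wpM2l ?rnorm_ge0//.
rewrite -lecR -rnormE normrX normrN normrM !rnormE rnormCR ger0_norm ?(ltW a0)//.
rewrite -rmorphM -rmorphXn lecR lerXn2r ?nnegrE ?mulr_ge0 ?rnorm_ge0 ?(ltW a0)//.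
by rewrite ler_piMr ?(ltW a0)// ltW.
Qed.

End Moebius.

(** * The extremal functions *)

Section Sharpness.
Context {R : realType} {H : normedModType R[i]} {n : nat}.

Lemma opnorm_id_le1 : opnorm (id_op H) <= 1.
Proof. by apply: opnorm_le => x. Qed.

Lemma opnorm_id : (exists u : H, u <> 0) -> opnorm (id_op H) = 1.
Proof.
move=> [u /eqP u0]; apply/eqP; rewrite eq_le opnorm_id_le1/=.
have u1 : 0 < rnorm u by rewrite lt_neqAle eq_sym rnorm_eq0 u0 rnorm_ge0.
by have := rnorm_opnorm (id_op H) u; rewrite ler_pMl.
Qed.

Variables (Q : set 'rV[R[i]]_n) (Qcirc : complete_circular_domain Q).
Variables (a : R) (a01 : 0 < a < 1) (c : 'I_n -> R[i]).
Hypothesis c1 : forall z, Q z -> rnorm (linear_form c z) < 1.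

Definition moebius_fun (z : 'rV[R[i]]_n) : bounded_op H :=
  moebius a (linear_form c z) *: id_op H.

Definition moebius_term (k : nat) (z : 'rV[R[i]]_n) : bounded_op H :=
  ((moebius_coef a k)%:C%C * linear_form c z ^+ k) *: id_op H.

Lemma moebius_admissible : bohr_admissible Q moebius_fun moebius_term.
Proof.
split.
- split=> [k|z Qz].
    have [A AE] := homogeneous_poly_linear_form_exp k c ((moebius_coef a k)%:C%C *: id_op H).
    by exists A => z; rewrite -AE scalerA mulrC.
  rewrite (_ : series _ = fun m => series (fun k =>
      (moebius_coef a k)%:C%C * linear_form c z ^+ k) m *: id_op H).
    by apply: cvgZl; exact: moebius_series_cvg (c1 Qz).
  by apply/funext => m; rewrite /series/= scaler_suml.
- move=> z Qz; rewrite -rnorm_bounded_op rnormZ.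
  apply: le_lt_trans (rnorm_moebius_lt1 a01 (c1 Qz)).
  by rewrite ler_piMr ?rnorm_ge0// opnorm_id_le1.
exists a%:C%C.
  by rewrite rnormE rnormCR ltcR ger0_norm; case/andP: a01 => // /ltW.
rewrite /moebius_fun /moebius /linear_form big1 => [|j _]; last by rewrite mxE mul0r.
by rewrite mulr0 !addr0 divr1.
Qed.

(** The tail of norms is a geometric series with ratio [a s]. With the lower bound of
    [powR_ge_ln_tangent], the Bohr inequality would contradict the last hypothesis multiplied by
    [1 - a]. *)
Lemma moebius_not_bohr p N (s : R) z : (exists u : H, u <> 0) ->
  0 < p -> (0 < N)%N -> 0 < s < 1 -> linear_form c z = s%:C%C ->
  p * (1 - s) * (1 - a * s) < (1 + a) * a ^+ N.-1 * s ^+ N * (a + s) ->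
  ~ bohr_inequality p N moebius_fun moebius_term z.
Proof.
(* From here on [N] is one less than in the statement. *)
move=> Hu p0; case: N => // N _ /andP[s0 s1] cz /= aN.
have /andP[a0 a1] := a01.
pose t := (a + s) / (1 + a * s).
have as0 : 0 < a * s by rewrite mulr_gt0.
have as1 : a * s < 1 by nra.
have ft : opnorm (moebius_fun z) = t.
  rewrite -rnorm_bounded_op rnormZ rnorm_bounded_op opnorm_id// mulr1 cz /moebius.
  rewrite -(rmorph1 (real_complex R)) -rmorphM -!rmorphD -fmorph_div rnormCR ger0_norm//.
  by rewrite divr_ge0// ltW// addr_gt0.
have Pt k : opnorm (moebius_term k.+1 z) = (1 - a ^+ 2) * s * (a * s) ^+ k.
  rewrite -rnorm_bounded_op rnormZ rnorm_bounded_op opnorm_id// mulr1 cz.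
  rewrite -rmorphXn -rmorphM rnormCR !normrM !normrX normrN/=.
  rewrite !(ger0_norm (ltW _))// ?subr_gt0 ?expr_lt1//; last exact: ltW.
  by rewrite exprMn [s ^+ k.+1]exprS; ring.
rewrite /bohr_inequality ft; set S := (\sum_(_ <= _ <oo) _)%E => tS.
have t0 : 0 < t by rewrite divr_gt0// addr_gt0.
have partial m : t `^ p + (1 - a ^+ 2) * s *
    ((a * s) ^+ N * (1 - (a * s) ^+ m) / (1 - a * s)) <= 1.
  have Sm : (\sum_(N.+1 <= k < (N + m).+1) (opnorm (moebius_term k z))%:E <= S)%E.
    by apply: nneseries_lim_ge => k _ _; rewrite lee_fin opnorm_ge0.
  have := le_trans (leeD2l _ Sm) tS.
  rewrite sumEFin -EFinD lee_fin; apply: le_trans; rewrite lerD2l big_add1/=.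
  rewrite (eq_bigr (fun k => (1 - a ^+ 2) * s * (a * s) ^+ k)) => [|k _]; last exact: Pt.
  rewrite -mulr_sumr le_eqVlt; apply/orP; left; apply/eqP; congr (_ * _).
  rewrite -{2}(add0n N) big_addn addKn.
  under eq_bigr do rewrite exprD mulrC.
  rewrite -mulr_sumr -mulrA big_mkord; congr (_ * _).
  rewrite -[1 - (a * s) ^+ m]opprB subrX1 -mulNr opprB mulrAC divff ?mul1r//.
  by rewrite gt_eqF// subr_gt0.
have full : t `^ p + (1 - a ^+ 2) * s * ((a * s) ^+ N / (1 - a * s)) <= 1.
  have cv : (fun m => t `^ p + (1 - a ^+ 2) * s *
        ((a * s) ^+ N * (1 - (a * s) ^+ m) / (1 - a * s))) @ \oo -->
      t `^ p + (1 - a ^+ 2) * s * ((a * s) ^+ N * (1 - 0) / (1 - a * s)).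
    apply: cvgD; first exact: cvg_cst.
    apply: cvgMr; apply: cvgMl; apply: cvgMr; apply: cvgB; first exact: cvg_cst.
    by apply: cvg_expr; rewrite ger0_norm ?(ltW as0).
  rewrite -[X in X / _]mulr1 -[X in _ * X / _]subr0.
  by apply: (cvgr_to_le cv); near=> m; exact: partial.
have := powR_ge_ln_tangent p0 t0.
have tE : (1 - t) / t = (1 - a) * (1 - s) / (a + s).
  by rewrite /t; field; rewrite !gt_eqF// addr_gt0.
rewrite tE => tp.
have : (1 - a ^+ 2) * s * ((a * s) ^+ N / (1 - a * s)) <= p * ((1 - a) * (1 - s) / (a + s)).
  lra.
apply/negP; rewrite -ltNge.
rewrite !mulrA ltr_pdivrMr ?addr_gt0// [ltRHS]mulrAC ltr_pdivlMr ?subr_gt0//.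
have a10 : 0 < 1 - a by rewrite subr_gt0.
have := aN; rewrite -(ltr_pM2l a10).
rewrite (_ : (1 - a) * (p * (1 - s) * (1 - a * s)) =
    p * (1 - a) * (1 - s) * (1 - a * s)).
  move/lt_le_trans; apply.
  by rewrite le_eqVlt exprMn exprS; apply/orP; left; apply/eqP; ring.
by ring.
Unshelve. all: by end_near. Qed.

End Sharpness.

(** At [a = 1] the difference of the two sides is [bohr_fun p N s], so by continuity it stays
    positive for [a] slightly below 1. *)
Lemma moebius_parameter (R : realType) (p : R) N (s : R) : (0 < N)%N ->
  0 < bohr_fun p N s ->
  exists2 a : R, 0 < a < 1 &
    p * (1 - s) * (1 - a * s) < (1 + a) * a ^+ N.-1 * s ^+ N * (a + s).
Proof.
move=> N0 Fs.
pose G : {poly R} := (1 + 'X) * 'X^(N.-1) * (s ^+ N)%:P * ('X + s%:P)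
  - (p * (1 - s))%:P * (1 - 'X * s%:P).
have GE a : G.[a] =
    (1 + a) * a ^+ N.-1 * s ^+ N * (a + s) - p * (1 - s) * (1 - a * s).
  by rewrite /G !hornerE.
have G1 : 0 < G.[1].
  rewrite GE expr1n !mulr1 mul1r; apply: lt_le_trans Fs _.
  by rewrite /bohr_fun le_eqVlt; apply/orP; left; apply/eqP; ring.
have [d d0 dP] := polyrcf.poly_cont 1 G G1.
(* The term [d / 2] keeps [1 - e] within the continuity radius, and [1 / 2] keeps it positive. *)
pose e := Num.min (d / 2) (1 / 2).
have e0 : 0 < e by rewrite lt_min !divr_gt0.
have ed : e < d by rewrite gt_min; apply/orP; left; lra.
have e1 : e < 1 by rewrite gt_min; apply/orP; right; lra.
exists (1 - e); first by apply/andP; split; lra.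
rewrite -subr_gt0 -GE.
have := dP (1 - e); rewrite addrAC subrr add0r normrN ger0_norm ?(ltW e0)// => /(_ ed).
by rewrite ltr_norml => /andP[+ _]; lra.
Qed.

Theorem theorem2p3 (R : realType) (H : completeNormedModType R[i])
    (dot : {dot H for Num.conj}) (dotE : forall u : H, dot u u = `|u| ^+ 2)
    (n : nat) (Q : set 'rV[R[i]]_n) (Qcirc : complete_circular_domain Q)
    (p : R) (p01 : 0 < p <= 1) (N : nat) (N1 : (1 <= N)%N) :
  exists2 r : R, unique (bohr_radius_eq p N) r &
    (forall (f : 'rV[R[i]]_n -> bounded_op H)
            (P : nat -> 'rV[R[i]]_n -> bounded_op H),
       bohr_admissible Q f P ->
       forall z, dilation r Q z -> bohr_inequality p N f P z) /\
    (convex_set (Q : set (convex_lmodType 'rV[R[i]]_n)) ->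
     Q <> setT -> (exists u : H, u <> 0) ->
     forall rho : R, r < rho < 1 ->
     exists (f : 'rV[R[i]]_n -> bounded_op H)
            (P : nat -> 'rV[R[i]]_n -> bounded_op H),
       bohr_admissible Q f P /\
       exists2 z, dilation rho Q z & ~ bohr_inequality p N f P z).
Proof.
have /andP[p0 p1] := p01.
have [r [rE runiq]] := bohr_radius_unique p0 N1.
exists r; first by split.
split; first by move=> f P fP; exact: (bohr_inequality_dilation dotE Qcirc p01 N1 rE fP).
move=> convQ QT Hu rho /andP[rrho rho1].
have [/andP[r0 r1] Fr] := rE.
have rho0 : 0 < rho by exact: lt_trans rrho.
have [c [c1 cP]] := supporting_linear_form Qcirc convQ QT.
(* With the form above [r / rho] at [z], its value [rho * x] at [rho z] exceeds [r], where
   [bohr_fun] is positive. *)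
have eta1 : r / rho < 1 by rewrite ltr_pdivrMr// mul1r.
have [z Qz [x etax cz]] := cP _ eta1.
have x1 : x < 1.
  by have := c1 _ Qz; rewrite cz rnormCR; apply: le_lt_trans; exact: ler_norm.
have rs : r < rho * x by rewrite mulrC -ltr_pdivrMr.
have s1 : rho * x < 1 by nra.
have Fs : 0 < bohr_fun p N (rho * x).
  by have := bohr_fun_increasing N p0 (ltW r0) rs (ltW s1); rewrite [X in X < _]Fr.
have [a a01 aN] := moebius_parameter N1 Fs.
exists (moebius_fun a c), (moebius_term a c); split; first exact: moebius_admissible.
exists (rho%:C%C *: z); first by exists z.
apply: (@moebius_not_bohr _ _ _ a a01 c p N (rho * x)) => //.
  by rewrite s1 (lt_trans r0).
by rewrite linear_formZ cz rmorphM.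
Qed.
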